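(* Let $1<p<\infty$, let $\Gamma$ be an uncountable set, and let $w:\Gamma\to(0,\infty)$ be a weight function. Then $\ell^{p,\infty}(\Gamma,w)$ is isomorphic to a space of one of the following types: (1) $\ell^{p,\infty}(\Gamma)$; (2) $E(\Pi_n)$ for some sequence $(\Pi_n)_{n=0}^\infty$ of pairwise disjoint sets with non-decreasing cardinalities such that $|\Pi_n|<\sup_m|\Pi_m|=|\Gamma|$ for all $n\geq0$; (3) $F(\Gamma)$; (4) $\ell^{p,\infty}(\Gamma)\oplus F(\Pi)$ for some set $\Pi$ with $\aleph_0<|\Pi|<|\Gamma|$; (5) $E(\Pi_n)\oplus F(\Pi)$, for some sequence $(\Pi_n)_{n=0}^\infty$ satisfying the condition in (2) and some set $\Pi$ with $\aleph_0<|\Pi|<|\Gamma|$.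
   Context: For a set $\Gamma$ and $w:\Gamma\to(0,\infty)$, $\ell^{p,\infty}(\Gamma,w)$ is the space of all $x:\Gamma\to\mathbb{R}$ with $\|x\|=\sup_{c>0}c\,(\mu\{|x|>c\})^{1/p}<\infty$, where $\mu(A)=\sum_{\gamma\in A}w(\gamma)$ for $A\subseteq\Gamma$. This expression is equivalent to a norm under which the space is a Banach space. $\ell^{p,\infty}(\Gamma)$ denotes the case $w\equiv1$. ''Isomorphic'' means linearly homeomorphic. $|A|$ denotes the cardinality of $A$. For a sequence $(\Gamma_n)_{n=0}^\infty$ of pairwise disjoint sets, $E(\Gamma_n)$ denotes $\ell^{p,\infty}(\bigcup_{n=0}^\infty\Gamma_n,w)$ with $w(\gamma)=2^n$ for $\gamma\in\Gamma_n$. For a set $\Gamma$, $F(\Gamma)$ denotes $\ell^{p,\infty}(\Gamma\times\mathbb{N},w)$ with $w(\gamma,n)=2^{-n}$ for $\gamma\in\Gamma$, $n\in\mathbb{N}=\{1,2,\ldots\}$. *)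

(* Defs.v *)
From HB Require Import structures.
From mathcomp Require Import all_boot all_order all_algebra.
From mathcomp Require Import all_classical all_reals all_analysis.

Set Implicit Arguments.
Unset Strict Implicit.
Unset Printing Implicit Defensive.

Import Order.TTheory GRing.Theory Num.Theory.
Import numFieldNormedType.Exports.

Local Open Scope classical_set_scope.
Local Open Scope ring_scope.

Section WeakLp.
Context {R : realType}.

Definition wmu (G : choiceType) (w : G -> {posnum R}) (A : set G) : \bar R :=
  (\esum_(g in A) ((w g)%:num)%:E)%E.

Definition wnorm (p : R) (G : choiceType) (w : G -> {posnum R}) (x : G -> R)
    : \bar R :=
  ereal_sup [set (c%:E * (wmu w [set g | c < `|x g|]%R) `^ (p^-1))%E
            | c in [set c : R | 0 < c]].

Section Quasinorm.
Variables (p : R) (p1 : 1 < p) (G : choiceType) (w : G -> {posnum R}).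
Implicit Types x y : G -> R.

Lemma wmu_ge0 A : (0 <= wmu w A)%E.
Proof. by apply: esum_ge0 => g _; rewrite lee_fin. Qed.

Lemma wmu_le A B : A `<=` B -> (wmu w A <= wmu w B)%E.
Proof.
move=> AB; rewrite /wmu esum_mkcond [leRHS]esum_mkcond.
apply: le_esum => g _; case: ifPn => [/set_mem/AB/mem_set ->//|_].
by case: ifPn => // _; rewrite lee_fin.
Qed.

Lemma wmuU A B : (wmu w (A `|` B) <= wmu w A + wmu w B)%E.
Proof.
rewrite /wmu esum_mkcond [X in (_ <= X + _)%E]esum_mkcond.
rewrite [X in (_ <= _ + X)%E]esum_mkcond -esumD.
- apply: le_esum => g _; rewrite in_setU.
  by case: (g \in A); case: (g \in B); rewrite /= ?adde0 ?add0e// leeDl// lee_fin.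
- by move=> g _; case: ifP => // _; rewrite lee_fin.
- by move=> g _; case: ifP => // _; rewrite lee_fin.
Qed.

Let pV0 : 0 < p^-1.
Proof. by rewrite invr_gt0 (lt_trans ltr01). Qed.

Lemma le_poweRV (a b : \bar R) : (0 <= a)%E -> (a <= b)%E ->
  (a `^ p^-1 <= b `^ p^-1)%E.
Proof.
move=> a0 ab; apply: gt0_ler_poweR => //; first exact: ltW.
- by rewrite in_itv/= a0 leey.
- by rewrite in_itv/= (le_trans a0 ab) leey.
Qed.

Lemma wnorm_ge0 x : (0 <= wnorm p w x)%E.
Proof.
apply: (@le_trans _ _ (1%:E * (wmu w [set g | 1 < `|x g|]%R) `^ (p^-1))%E).
  by rewrite mul1e poweR_ge0.
by apply: ereal_sup_ubound; exists 1 => /=.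
Qed.

Lemma wnormZ (k : R) x : (wnorm p w (k *: x)%R <= `|k|%:E * wnorm p w x)%E.
Proof.
apply: ge_ereal_sup => _ [c /= c0 <-].
have [->|k0] := eqVneq k 0.
  rewrite [X in wmu w X](_ : _ = set0); last first.
    apply/seteqP; split => // g /=; rewrite scale0r normr0.
    by rewrite ltNge (ltW c0).
  by rewrite /wmu esum_set0 poweR0r ?gt_eqF// mule0 normr0 mul0e.
have k0' : 0 < `|k| by rewrite normr_gt0.
rewrite [X in (X%:E * _)%E](_ : c = `|k| * (c / `|k|)); last first.
  by rewrite mulrCA divff ?mulr1// gt_eqF.
rewrite EFinM -muleA lee_pmul2l//.
apply: ereal_sup_ubound; exists (c / `|k|) => /=; first by rewrite divr_gt0.
congr (_ * (wmu w _) `^ _)%E; apply/seteqP; split => g /=;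
  by rewrite [(k *: x) g]/(k * x g) normrM ltr_pdivrMr// mulrC.
Qed.

Lemma wnorm0 : wnorm p w 0 = 0%E.
Proof.
apply/eqP; rewrite eq_le wnorm_ge0 andbT.
have := wnormZ 0 0; rewrite scale0r => /le_trans -> //.
by rewrite normr0 mul0e.
Qed.

Lemma wnormD x y (M : \bar R) : (wnorm p w x <= M)%E -> (wnorm p w y <= M)%E ->
  (wnorm p w (x + y)%R <= 4%:E * M)%E.
Proof.
move=> xM yM; apply: ge_ereal_sup => _ [c /= c0 <-].
pose S (z : G -> R) := [set g | c / 2 < `|z g| :> R].
have HS z : (wnorm p w z <= M)%E ->
    ((c / 2)%:E * (wmu w (S z)) `^ p^-1 <= M)%E.
  apply: le_trans; apply: ereal_sup_ubound; exists (c / 2) => //=.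
  by rewrite divr_gt0.
pose m := maxe (wmu w (S x)) (wmu w (S y)).
have m0 : (0 <= m)%E by rewrite le_max wmu_ge0.
have mM : ((c / 2)%:E * m `^ p^-1 <= M)%E.
  by rewrite /m; case: (leP (wmu w (S x))) => _; exact: HS.
have le1 : (wmu w [set g | c < `|(x + y)%R g|]%R <= 2%:E * m)%E.
  apply: (@le_trans _ _ (wmu w (S x `|` S y))).
    apply: wmu_le => g /= H; apply: contrapT => /not_orP[/negP Hx /negP Hy].
    move: Hx Hy; rewrite -!leNgt => Hx Hy.
    have := lt_le_trans H (ler_normD (x g) (y g)).
    by rewrite ltNge (le_trans (lerD Hx Hy))// -splitr.
  apply: (le_trans (wmuU _ _)).
  rewrite -[2%R]/(1 + 1)%R EFinD ge0_muleDl ?lee_fin// mul1e.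
  by apply: leeD; rewrite le_max lexx ?orbT.
have -> : (4%:E * M = 2%:E * (2%:E * M))%E by rewrite muleA -EFinM -natrM.
rewrite [X in (X%:E * _)%E](_ : c = 2 * (c / 2)); last first.
  by rewrite mulrCA divff ?mulr1.
rewrite EFinM -muleA lee_pmul2l//.
apply: (@le_trans _ _ ((c / 2)%:E * (2%:E * m `^ p^-1))%E).
  rewrite lee_pmul2l ?lte_fin ?divr_gt0//.
  apply: (le_trans (le_poweRV (wmu_ge0 _) le1)).
  rewrite poweRM//; apply: lee_wpmul2r; first exact: poweR_ge0.
  rewrite poweR_EFin lee_fin -[leRHS]powRr1//.
  by apply: ler_powR; rewrite ?ler1n// invf_le1 ?(ltW p1)// (lt_trans ltr01).
by rewrite muleCA lee_pmul2l.
Qed.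

(* the argument [p1] only serves to make the closure properties inferable *)
Definition weakLp_pred of 1 < p : {pred G -> R} :=
  mem [set x : G -> R | (wnorm p w x < +oo)%E].

Lemma weakLp_submod_closed : submod_closed (weakLp_pred p1).
Proof.
split=> [|k x y]; rewrite !inE/= ?wnorm0// => xo yo.
apply: (@le_lt_trans _ _
    (4%:E * maxe (`|k|%:E * wnorm p w x) (wnorm p w y))%E).
  by apply: wnormD; rewrite le_max ?wnormZ ?lexx ?orbT.
rewrite lte_mul_pinfty// gt_max yo andbT.
by rewrite lte_mul_pinfty// wnorm_ge0.
Qed.

HB.instance Definition _ :=
  GRing.isSubmodClosed.Build R (G -> R) (weakLp_pred p1) weakLp_submod_closed.

Definition weakLp : Type := {x : G -> R | x \in weakLp_pred p1}.

HB.instance Definition _ := SubType.on weakLp.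
HB.instance Definition _ := Choice.on weakLp.
HB.instance Definition _ := [SubChoice_isSubLmodule of weakLp by <:].

(* the topology whose neighbourhoods are given by the quasi-norm balls; it is
   also that of any norm equivalent to [wnorm] *)
Definition weakLp_nbhs (x : weakLp) : set_system weakLp :=
  [set U | exists2 e : R, 0 < e &
     forall y : weakLp, (wnorm p w (val (y - x)%R) < e%:E)%E -> U y].

HB.instance Definition _ := hasNbhs.Build weakLp weakLp_nbhs.

Lemma weakLp_nbhs_filter (x : weakLp) : ProperFilter (weakLp_nbhs x).
Proof.
apply: Build_ProperFilter_ex.
  by move=> U [e e0 eU]; exists x; apply: eU; rewrite subrr raddf0 wnorm0 lte_fin.
split.
- by exists 1.
- move=> U V [e e0 eU] [d d0 dV]; exists (Num.min e d); first by rewrite lt_min e0.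
  move=> y; rewrite EFin_min lt_min => /andP[ye yd].
  by split; [exact: eU|exact: dV].
- by move=> U V UV [e e0 eU]; exists e => // y /eU /UV.
Qed.

Lemma weakLp_nbhs_singleton (x : weakLp) (A : set weakLp) : weakLp_nbhs x A -> A x.
Proof. by case=> e e0; apply; rewrite subrr raddf0 wnorm0 lte_fin. Qed.

Lemma weakLp_nbhs_nbhs (x : weakLp) (A : set weakLp) :
  weakLp_nbhs x A -> weakLp_nbhs x (weakLp_nbhs^~ A).
Proof.
case=> e e0 eA; have d0 : 0 < e / 8 by rewrite divr_gt0.
exists (e / 8) => // y yx; exists (e / 8) => // z zy.
apply: eA; have -> : z - x = (z - y) + (y - x) by rewrite addrA subrK.
rewrite raddfD/=; apply: le_lt_trans (wnormD (ltW zy) (ltW yx)) _.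
by rewrite -EFinM lte_fin mulrCA gtr_pMr// ltr_pdivrMr// mul1r ltr_nat.
Qed.

HB.instance Definition _ := Nbhs_isNbhsTopological.Build weakLp
  weakLp_nbhs_filter weakLp_nbhs_singleton weakLp_nbhs_nbhs.

End Quasinorm.
End WeakLp.

(* equips products of [preTopologicalLmodType]s with that structure *)
HB.saturate prod.

Definition isomorphic (R : realType) (U V : preTopologicalLmodType R) : Prop :=
  exists (f : {linear U -> V}) (g : V -> U),
    [/\ cancel f g, cancel g f, continuous f & continuous g].

Definition card_lt (T U : Type) (A : set T) (B : set U) : Prop :=
  (A #<= B)%card /\ ~ (B #<= A)%card.

(* $\sup_m |P_m| = |B|$, the supremum being taken among cardinals *)
Definition card_sup_eq (T U : Type) (P : nat -> set T) (B : set U) : Prop :=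
  (forall n, P n #<= B)%card /\
  (forall (V : Type) (C : set V), (forall n, P n #<= C) -> B #<= C)%card.

Section Spaces.
Context {R : realType} (p : R) (p1 : 1 < p).

Definition ell (G : choiceType) := weakLp p1 (fun _ : G => 1%:pos : {posnum R}).

(* for pairwise disjoint [P], [n] below is the unique index with [P n (val g)] *)
Definition Eweight (T : choiceType) (P : nat -> set T) (g : \bigcup_n P n)
    : {posnum R} :=
  let n := xget 0%N [set n | P n (val g)] in (2 ^+ n)%:pos.

Definition E (T : choiceType) (P : nat -> set T) := weakLp p1 (@Eweight T P).

(* $\{1,2,\ldots\}$ is indexed by [nat], whence the shift *)
Definition F (G : choiceType) :=
  weakLp p1 (fun g : G * nat => (2^-1 ^+ g.2.+1)%:pos : {posnum R}).

End Spaces.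

Definition E_admissible (T : choiceType) (P : nat -> set T) (G : choiceType)
    : Prop :=
  [/\ trivIset setT P,
      forall m n, (m <= n)%N -> (P m #<= P n)%card,
      card_sup_eq P [set: G] &
      forall n, card_lt (P n) [set: G]].

(* Main.v *)
Require Import Defs.
From HB Require Import structures.
From mathcomp Require Import all_boot all_order all_algebra.
From mathcomp Require Import all_classical all_reals all_analysis.
From mathcomp Require Import zify ring.

(** Up to an equivalent quasi-norm all weights are powers of two, so the space
is described by a level function [L : G -> int], the atom [g] having weight
[2 ^ L g].  Everything rests on two ways of finding one such space as a
complemented subspace of another, and on Pelczynski's decomposition method.

First, an atom may be split into [2 ^ k] atoms of a level lower by [k]: the
functions constant on the pieces form a subspace, and averaging over the pieces
projects onto it.  Averaging is bounded because [1 < p] ([weak_bound_mass],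
[bounded_avg], [complemented_split]).

Secondly, any countable family of atoms, whatever its weights, yields a space
complemented in that of countably many atoms of weight one
([complemented_nat]).  The restrictions of a function to the first [n] atoms,
for all [n], are placed in blocks with rapidly growing scales; on such blocks
the quasi-norm is equivalent to the supremum of the quasi-norms of the blocks,
and the function is recovered from the blocks by a limit along an ultrafilter.

Pelczynski's method takes the following form: if countably many copies of [X]
are complemented in [Y], then [Y] is isomorphic to the sum of [Y] and [X]
([iso_absorb]).  Consequently a countable family of atoms may be added to or
removed from an uncountable one ([iso_countable]).  After the removal of all
atoms of countable levels, each level set has the size of countably many copies
of itself; such families of atoms are called [stable].  For two stable families
an isomorphism follows as soon as each of them embeds into countably many copies
of the other by a map that does not raise levels by more than a constant
([iso_level_emb]).

The classification is then a matter of cardinals.  Let [T m] be the set of atoms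
of level at most [- m].  If all [T m] have the size of [G], the space is [F G].
Otherwise the cardinals of the [T m] are eventually equal, from [T N] on say,
and the atoms of [T N] are split off: they form a space [F (T N)], unless they
are countable and can be absorbed.  The remaining levels are bounded below.  If for
some [n] there are as many atoms as in [G] of level at most [n], they all have
weight one up to splitting, and the space is [ell G]; if not, the atoms of level
at most [n] are counted anew for each [n], as atoms of weight [2 ^ n], and this
gives the space [E] ([ell_or_E]). *)

Set Implicit Arguments.
Unset Strict Implicit.
Unset Printing Implicit Defensive.

Import Order.TTheory GRing.Theory Num.Theory.
Import numFieldNormedType.Exports.
Local Open Scope classical_set_scope.

(** * Cardinals *)

Definition emb (A B : Type) := exists f : A -> B, injective f.

Lemma emb_refl A : emb A A.
Proof. by exists id. Qed.

Lemma emb_trans A B C : emb A B -> emb B C -> emb A C.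
Proof. by move=> [f fI] [g gI]; exists (g \o f); exact: inj_comp. Qed.

Lemma emb_prod A B C D : emb A B -> emb C D -> emb (A * C) (B * D).
Proof.
move=> [f fI] [g gI]; exists (fun x => (f x.1, g x.2)).
by move=> [a c] [a' c'] /= [/fI -> /gI ->].
Qed.

Lemma emb_countType (A : countType) : emb A nat.
Proof. by exists pickle; exact: pcan_inj pickleK. Qed.

Lemma card_le_emb T U (A : set T) (B : set U) : (A #<= B)%card <-> emb A B.
Proof.
split=> [/card_leP[f]|[f fI]]; last first.
  by apply/card_leP/injfunPex; exists f => // x y _ _; exact: fI.
by exists f => x y; apply: inj; rewrite inE.
Qed.

Lemma emb_setT T : emb T [set: T].
Proof.
exists (fun x => SigSub (mem_set (I : [set: T] x))) => x y.
by move=> /(congr1 val).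
Qed.

Lemma setT_emb T : emb [set: T] T.
Proof. by exists val; exact: val_inj. Qed.

Lemma subset_emb T (A : set T) : emb A T.
Proof. by exists val; exact: val_inj. Qed.

Lemma countable_emb T : countable [set: T] <-> emb T nat.
Proof.
rewrite /countable card_le_emb; split=> h.
  exact: emb_trans (emb_setT T) (emb_trans h (setT_emb _)).
exact: emb_trans (setT_emb _) (emb_trans h (emb_setT _)).
Qed.

(** A maximal set [S] of choice functions any two of which differ at every
index must exhaust one of the [T i]: otherwise a choice of missed values could
be added to [S].  Evaluation at the other indices then embeds that [T i]. *)
Lemma exists_smallest (I : Type) (i0 : I) (T : I -> Type) :
  exists i, forall j, emb (T i) (T j).
Proof.
pose P (S : set (forall i, T i)) :=
  forall s t, S s -> S t -> forall i, s i = t i -> s = t.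
have [F FP Ftot s t [X FX Xs] [Y FY Yt]|S [PS maxS]] := @Zorn_bigcup _ P.
  by have [XY|YX] := Ftot _ _ FX FY; [apply: (FP Y)|apply: (FP X)] => //;
    [exact: XY|exact: YX].
have [i Si] : exists i, forall x : T i, exists s, S s /\ s i = x.
  apply: contrapT => /forallNP noti.
  have noti' i : exists x : T i, ~ exists s, S s /\ s i = x.
    exact/existsNP/noti.
  pose x i := projT1 (cid (noti' i)).
  have xP i : ~ exists s, S s /\ s i = x i := projT2 (cid (noti' i)).
  apply: (maxS (S `|` [set x])); first split.
  - by move=> s; left.
  - move=> SxS; apply: (xP i0); exists x; split => //.
    by apply: SxS; right.
  - move=> s t [Ss|->] [St|->] // i sti; first exact: (PS s t Ss St i).
      by case: (xP i); exists s.
    by case: (xP i); exists t.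
exists i => j; have [f fP] := choice Si.
exists (fun x => f x j) => x y fxy.
by rewrite -(fP x).2 -(fP y).2 (PS _ _ (fP x).1 (fP y).1 _ fxy).
Qed.

Lemma emb_total A B : emb A B \/ emb B A.
Proof.
have [[] h] := exists_smallest true (fun b : bool => if b then A else B).
  by left; exact: (h false).
by right; exact: (h true).
Qed.

Lemma not_infinite_nat T (A : set T) : ~ emb nat A ->
  exists c : T -> nat, forall x y, A x -> A y -> c x = c y -> x = y.
Proof.
move=> nA; have : finite_set A.
  apply: contrapT => /infiniteP/card_le_emb h; apply: nA.
  exact: emb_trans (emb_setT _) h.
move=> /finite_set_countable/countable_injP[c cI]; exists c => x y Ax Ay.
by apply: cI; exact/mem_set.
Qed.

(** A maximal disjoint family of injective sequences covers [D] up to a finite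
set, which can be fitted in with one of the sequences, and each sequence has
room for countably many copies of itself. *)
Lemma emb_prod_nat D : emb nat D -> emb (D * nat) D.
Proof.
move=> [e0 e0I]; pose P (F : set (nat -> D)) :=
  forall f g, F f -> F g -> forall m n, f m = g n -> f = g /\ m = n.
have [F FP Ftot s t [X FX Xs] [Y FY Yt]|F [PF maxF]] := @Zorn_bigcup _ P.
  by have [XY|YX] := Ftot _ _ FX FY; [apply: (FP Y)|apply: (FP X)] => //;
    [exact: XY|exact: YX].
pose A := [set x | exists fm : (nat -> D) * nat, F fm.1 /\ fm.1 fm.2 = x].
have nA (e : nat -> D) : injective e -> ~ (forall n, ~ A (e n)).
  move=> eI eA; apply: (maxF (F `|` [set e])); first split.
  - by move=> s; left.
  - move=> FeF; apply: (eA 0); exists (e, 0); split => //.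
    by apply: FeF; right.
  - move=> f g [Ff|->] [Fg|->] m n fg; first exact: PF.
    + by case: (eA n); exists (f, m).
    + by case: (eA m); exists (g, n).
    + by split=> //; exact: eI.
have [f0 Ff0] : exists f0, F f0.
  apply: contrapT => /forallNP F0; apply: (nA e0 e0I) => n [[f m] /= [Ff _]].
  exact: (F0 f).
have [|c cI] := @not_infinite_nat _ (~` A).
  move=> [e eI]; apply: (nA (val \o e)); first exact: inj_comp val_inj eI.
  by move=> n; have /set_mem := valP (e n).
pose fm x : (nat -> D) * nat * bool :=
  if pselect (A x) is left Ax then (projT1 (cid Ax), false)
  else (f0, c x, true).
have fmF x : F (fm x).1.1.
  by rewrite /fm; case: pselect => // Ax; case: (cid Ax) => /= ? [].
have fmI : injective fm.
  move=> x y; rewrite /fm; case: pselect => Ax; case: pselect => Ay.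
  - case: (cid Ax) => [[f m] /= [_ <-]]; case: (cid Ay) => [[g n] /= [_ <-]].
    by case=> -> ->.
  - by case: (cid Ax).
  - by case: (cid Ay).
  - by case=> /cI; exact.
exists (fun x => (fm x.1).1.1 (pickle ((fm x.1).1.2, (fm x.1).2, x.2))).
move=> [x m] [y n] /= /(PF _ _ (fmF x) (fmF y))[eqf].
move=> /(pcan_inj pickleK)[eqm eqb ->]; congr pair; apply: fmI.
by move: (fm x) (fm y) eqf eqm eqb => [[? ?] ?] [[? ?] ?] /= -> -> ->.
Qed.

Lemma uncountable_infinite T : ~ emb T nat -> emb nat T.
Proof. by case: (emb_total nat T). Qed.

(** A finite [B] is excluded, since [B * nat] would then be countable. *)
Lemma emb_absorb_nat T B : ~ emb T nat -> emb T (B * nat) -> emb T B.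
Proof.
move=> uT TB.
have [|/(@not_infinite_nat _ setT)[]] := pselect (emb nat [set: B]).
  by move=> /emb_trans/(_ (@setT_emb _))/emb_prod_nat; exact: emb_trans.
move=> c cI; case: uT; apply: emb_trans TB _.
apply: emb_trans (emb_countType (nat * nat)%type); apply: emb_prod (emb_refl _).
by exists c => x y; exact: cI.
Qed.

Lemma emb_sum A B : emb A B -> emb (A + B) (B * nat).
Proof.
move=> [f fI].
exists (fun x => match x with inl a => (f a, 0) | inr b => (b, 1) end).
by move=> [x|x] [y|y] // []; [move=> /fI ->|move=> ->].
Qed.

Lemma emb_sumC A B : emb (A + B) (B + A).
Proof.
exists (fun x => match x with inl a => inr a | inr b => inl b end).
by case=> x [] y // [->].
Qed.

Lemma emb_split T (A : set T) : emb T (A + (~` A : set T)).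
Proof.
exists (fun x => match pselect (A x) with
  | left Ax => inl (SigSub (mem_set Ax))
  | right nAx => inr (SigSub (mem_set (nAx : (~` A) x))) end) => x y.
by do 2 case: pselect => //; move=> Dx Dy [].
Qed.

(** The smaller of the two parts embeds into the larger one, and hence the whole
into two copies of the larger one. *)
Lemma emb_setC T (A : set T) :
  ~ emb T nat -> ~ emb T A -> emb T (~` A : set T).
Proof.
move=> uT nTA; have [AB|BA] := emb_total A (~` A : set T).
  exact: (emb_absorb_nat uT (emb_trans (emb_split A) (emb_sum AB))).
case: nTA; apply: (emb_absorb_nat uT).
exact: emb_trans (emb_trans (emb_split A) (emb_sumC _ _)) (emb_sum BA).
Qed.

Local Open Scope ring_scope.

(** * Bounded operators between weak Lp spaces *)

Section Weak.
Context {R : realType} (p : R) (p1 : 1 < p).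

Let p0 : 0 < p. Proof. exact: lt_trans ltr01 p1. Qed.

Lemma powRM_gt0 (a b r : R) : 0 < a -> 0 < b -> (a * b) `^ r = a `^ r * b `^ r.
Proof. by move=> a0 b0; rewrite powRM// ltW. Qed.

(** The [p]-th power of the quasi-norm of [x] is at most [M].  Testing on finite
sets of atoms keeps all sums finite and all values real. *)
Definition weak_bound (A : eqType) (w x : A -> R) (M : R) :=
  forall (s : seq A) (c : R), uniq s -> 0 < c ->
    (forall a, a \in s -> c < `|x a|) -> c `^ p * \sum_(a <- s) w a <= M.

Definition Lp (A : eqType) (w x : A -> R) := exists M, weak_bound w x M.

Section Basic.
Variables (A : eqType) (w : A -> R).
Implicit Types x y : A -> R.

Lemma weak_bound_ge0 x M : weak_bound w x M -> 0 <= M.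
Proof. by move=> /(_ [::] 1 isT ltr01); rewrite big_nil mulr0; exact. Qed.

Lemma weak_boundZ x k M : weak_bound w x M ->
  weak_bound w (fun a => k * x a) (`|k| `^ p * M).
Proof.
move=> xM s c us c0 sx; have M0 := weak_bound_ge0 xM.
have [k0|k0] := eqVneq k 0.
  case: s {us} sx => [|a s] sx.
    by rewrite big_nil mulr0 mulr_ge0// powR_ge0.
  have := sx a (mem_head _ _); rewrite k0 mul0r normr0 => /(lt_trans c0).
  by rewrite ltxx.
have k0' : 0 < `|k| by rewrite normr_gt0.
have -> : c = `|k| * (c / `|k|) by rewrite mulrC divfK// gt_eqF.
rewrite powRM_gt0 ?divr_gt0// -mulrA ler_pM2l ?powR_gt0//.
apply: xM => //; first by rewrite divr_gt0.
by move=> a /sx; rewrite normrM ltr_pdivrMr// mulrC.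
Qed.

Hypothesis w0 : forall a, 0 < w a.

Lemma weak_boundD x y M N : weak_bound w x M -> weak_bound w y N ->
  weak_bound w (fun a => x a + y a) (2 `^ p * (M + N)).
Proof.
move=> xM yN s c us c0 sxy.
have -> : c = 2 * (c / 2) by rewrite mulrC divfK.
set d := c / 2; have d0 : 0 < d by rewrite divr_gt0.
rewrite powRM_gt0// -mulrA ler_pM2l ?powR_gt0//.
pose s1 := [seq a <- s | d < `|x a|]; pose s2 := [seq a <- s | d < `|y a|].
apply: (@le_trans _ _ (d `^ p * (\sum_(a <- s1) w a + \sum_(a <- s2) w a))).
  rewrite ler_pM2l ?powR_gt0// !big_filter.
  rewrite [X in X + _]big_mkcond [X in _ + X]big_mkcond -big_split/=.
  rewrite big_seq [leRHS]big_seq; apply: ler_sum => a /sxy cxy.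
  case: (ltP d) => h1; case: (ltP d) => h2;
    rewrite ?addr0 ?add0r ?lerDl ?(ltW (w0 a))//.
  move: cxy; rewrite ltNge (le_trans (ler_normD _ _))//.
  by rewrite [leRHS]splitr lerD.
rewrite mulrDr lerD//.
  apply: xM => //; first exact: filter_uniq.
  by move=> a; rewrite mem_filter => /andP[].
apply: yN => //; first exact: filter_uniq.
by move=> a; rewrite mem_filter => /andP[].
Qed.

(** Chebyshev's inequality at a single atom; the factor [2 `^ p] pays for the
strict inequality in [weak_bound]. *)
Lemma weak_bound1 x M a : weak_bound w x M -> `|x a| `^ p * w a <= 2 `^ p * M.
Proof.
move=> xM; have [xa0|xa0] := eqVneq (x a) 0.
  rewrite xa0 normr0 powR0 ?gt_eqF// mul0r.
  by rewrite mulr_ge0 ?powR_ge0 ?(weak_bound_ge0 xM).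
have h : 0 < `|x a| / 2 by rewrite divr_gt0// normr_gt0.
have -> : `|x a| = 2 * (`|x a| / 2) by rewrite mulrC divfK.
rewrite powRM_gt0// -mulrA ler_pM2l ?powR_gt0//.
have := xM [:: a] (`|x a| / 2) isT h; rewrite big_seq1; apply=> b.
by rewrite inE => /eqP ->; rewrite ltr_pdivrMr// ltr_pMr ?normr_gt0// ltr1n.
Qed.

Lemma LpL x y k : Lp w x -> Lp w y -> Lp w (fun a => k * x a + y a).
Proof.
move=> [M /(weak_boundZ (k := k)) xM] [N yN].
by eexists; exact: weak_boundD xM yN.
Qed.

Lemma weak_bound0 : weak_bound w (fun=> 0) 0.
Proof.
move=> [|a s] c _ c0 sx; first by rewrite big_nil mulr0.
by have := sx a (mem_head _ _); rewrite normr0 => /(lt_trans c0); rewrite ltxx.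
Qed.

End Basic.

(** The operators are defined on all functions, but linearity is required on
the weak Lp space only: a limit along an ultrafilter is linear on bounded
sequences only. *)
Definition bounded_op (A B : eqType) (w : A -> R) (v : B -> R)
    (T : (A -> R) -> B -> R) :=
  (forall k x y, Lp w x -> Lp w y ->
     T (fun a => k * x a + y a) = (fun b => k * T x b + T y b)) /\
  exists2 K, 0 <= K &
    forall x M, weak_bound w x M -> weak_bound v (T x) (K * M).

Lemma bounded_Lp (A B : eqType) (w : A -> R) (v : B -> R) T x :
  bounded_op w v T -> Lp w x -> Lp v (T x).
Proof. by move=> [_ [K K0 TK]] [M /TK xM]; exists (K * M). Qed.

Lemma bounded_id (A : eqType) (w : A -> R) : bounded_op w w id.
Proof. by split=> //; exists 1 => // x M; rewrite mul1r. Qed.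

Lemma bounded_comp (A B C : eqType) (w : A -> R) (v : B -> R) (u : C -> R) T S :
  bounded_op v u S -> bounded_op w v T -> bounded_op w u (S \o T).
Proof.
move=> bS bT; have [SL [K K0 SK]] := bS; have [TL [N N0 TN]] := bT; split.
  by move=> k x y Lx Ly /=; rewrite TL// SL//; exact: bounded_Lp bT _.
by exists (K * N) => [|x M /TN/SK]; rewrite ?mulr_ge0// mulrA.
Qed.

Lemma bounded_lin (A B : eqType) (w : A -> R) (v : B -> R) h T S :
  (forall b, 0 < v b) -> bounded_op w v T -> bounded_op w v S ->
  bounded_op w v (fun x b => h * T x b + S x b).
Proof.
move=> v0 [TL [K K0 TK]] [SL [N N0 SN]]; split.
  move=> k x y Lx Ly; rewrite TL// SL//; apply/funext => b.
  by rewrite !mulrDr mulrCA !addrA; congr (_ + _); rewrite addrAC.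
exists (2 `^ p * (`|h| `^ p * K + N)) => [|x M xM].
  by rewrite mulr_ge0 ?addr_ge0 ?mulr_ge0// powR_ge0.
rewrite -mulrA mulrDl -mulrA; apply: weak_boundD => //; last exact: SN.
exact/weak_boundZ/TK.
Qed.

(** Restriction to a set of atoms, extension by zero and spreading the value at
an atom over several atoms are all of this form. *)
Definition pull (A B : Type) (f : B -> option A) (x : A -> R) (b : B) :=
  if f b is Some a then x a else 0.

(** The set where [pull f x] exceeds a level is a union of fibres of [f]. *)
Lemma bounded_pull (A B : eqType) (w : A -> R) (v : B -> R)
    (f : B -> option A) K :
  0 <= K ->
  (forall a s, uniq s -> (forall b, b \in s -> f b = Some a) ->
     \sum_(b <- s) v b <= K * w a) ->
  bounded_op w v (pull f).
Proof.
move=> K0 fK; split.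
  move=> k x y _ _; apply/funext => b; rewrite /pull.
  by case: (f b) => //; rewrite mulr0 addr0.
exists K => // x M xM s c us c0 sx.
have fs b : b \in s -> exists2 a, f b = Some a & c < `|x a|.
  move=> /sx; rewrite /pull; case: (f b) => [a|]; first by exists a.
  by rewrite normr0 => /(lt_trans c0); rewrite ltxx.
pose t := undup (pmap f s).
have ut : uniq t by exact: undup_uniq.
have tP a : (a \in t) = (Some a \in map f s) by rewrite mem_undup mem_pmap.
apply: (@le_trans _ _ (c `^ p * \sum_(a <- t) K * w a)); last first.
  rewrite -mulr_sumr mulrCA ler_wpM2l//; apply: xM => // a.
  by rewrite tP => /mapP[b /fs[a' fb ca]]; rewrite fb => -[->].
rewrite ler_wpM2l ?powR_ge0//.
apply: (@le_trans _ _ (\sum_(a <- t) \sum_(b <- s | f b == Some a) v b)).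
  under [leRHS]eq_bigr do rewrite big_mkcond.
  rewrite exchange_big/= big_seq [leRHS]big_seq le_eqVlt; apply/orP; left.
  apply/eqP; apply: eq_bigr => b bs; have [a fb _] := fs b bs.
  have at_ : a \in t by rewrite tP -fb map_f.
  rewrite (bigD1_seq a)//= fb eqxx big1 ?addr0// => a' a'a.
  by case: eqP => // -[aa']; rewrite aa' eqxx in a'a.
apply: ler_sum => a _; rewrite -big_filter; apply: fK; first exact: filter_uniq.
by move=> b; rewrite mem_filter => /andP[/eqP].
Qed.

Lemma seq_le1 (B : eqType) (s : seq B) b :
  uniq s -> {in s, forall b', b' = b} -> s = [::] \/ s = [:: b].
Proof.
case: s => [|b1 [|b2 s]] /=; first by left.
  by move=> _ h; right; congr [:: _]; apply: h; rewrite mem_head.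
move=> /andP[b12 _] h; have e1 := h b1 (mem_head _ _).
have e2 : b2 = b by apply: h; rewrite !inE eqxx orbT.
by rewrite e1 e2 mem_head in b12.
Qed.

(** Over a partially defined injection the fibres are single atoms. *)
Lemma bounded_pull_inj (A B : eqType) (w : A -> R) (v : B -> R)
    (f : B -> option A) K :
  0 <= K -> (forall a, 0 < w a) ->
  (forall b b' a, f b = Some a -> f b' = Some a -> b = b') ->
  (forall b a, f b = Some a -> v b <= K * w a) ->
  bounded_op w v (pull f).
Proof.
move=> K0 w0 fI fK; apply: (@bounded_pull _ _ _ _ _ K) => // a [|b s] us sa.
  by rewrite big_nil; apply: mulr_ge0 => //; exact: ltW.
have sb : {in b :: s, forall b', b' = b}.
  by move=> b' /sa fb'; apply: fI fb' (sa b (mem_head _ _)).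
by have [//|->] := seq_le1 us sb; rewrite big_seq1 fK// sa// mem_head.
Qed.

(** * Averaging *)

(** The weak type inequality controls the mass above a level, by dyadic
decomposition; the geometric series converges because [1 < p]. *)
Lemma weak_bound_mass : exists2 C : R, 0 < C &
  forall (B : eqType) (v g : B -> R) (M : R) (t : seq B) (d : R),
  (forall b, 0 < v b) -> weak_bound v g M -> uniq t -> 0 < d ->
  (forall b, b \in t -> d < `|g b|) ->
  \sum_(b <- t) v b * `|g b| <= C * M * d `^ (1 - p).
Proof.
have q1 : 2 `^ (1 - p) < 1 :> R.
  by rewrite /powR gt_eqF// expR_lt1 pmulr_llt0 ?subr_lt0// ln_gt0// ltr1n.
have [C C0 CE] : exists2 C : R, 0 < C & C = C * 2 `^ (1 - p) + 2.
  (* the sum of the geometric series of ratio [2 `^ (1 - p)], times 2 *)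
  exists (2 / (1 - 2 `^ (1 - p))); first by rewrite divr_gt0// subr_gt0.
  by field; rewrite gt_eqF// subr_gt0.
exists C => // B v g M t d v0 gM ut d0 td; have M0 := weak_bound_ge0 gM.
have [m] : exists m, forall b, b \in t -> `|g b| <= 2 ^+ m * d.
  exists (Num.bound (\sum_(b <- t) `|g b| / d)) => b bt.
  rewrite -ler_pdivrMr//.
  have := ltW (upper_nthrootP (leqnn (Num.bound (\sum_(b <- t) `|g b| / d)))).
  apply: le_trans.
  rewrite (bigD1_seq b)//= lerDl; apply: sumr_ge0 => b' _.
  by apply: divr_ge0 => //; exact: ltW.
elim: m t d ut d0 td => [|m IH] t d ut d0 td tm.
  case: t tm ut td => [|b t] tm ut td.
    rewrite big_nil; apply: mulr_ge0; last exact: powR_ge0.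
    by apply: mulr_ge0 => //; exact: ltW.
  have := td b (mem_head _ _); have := tm b (mem_head _ _).
  by rewrite expr0 mul1r leNgt => /negbTE ->.
rewrite (bigID (fun b => 2 * d < `|g b|))/=.
have -> : C * M * d `^ (1 - p) = C * M * (2 * d) `^ (1 - p) +
    2 * M * d `^ (1 - p).
  rewrite powRM_gt0//.
  by rewrite {1}CE; ring.
apply: lerD; rewrite -big_filter.
  apply: IH => [|||b]; rewrite ?filter_uniq ?mulr_gt0//.
    by move=> b; rewrite mem_filter => /andP[].
  by rewrite mem_filter => /andP[_ /tm]; rewrite exprSr mulrA.
set t' := seq.filter _ _.
apply: (@le_trans _ _ (2 * d * \sum_(b <- t') v b)).
  rewrite mulr_sumr big_seq [leRHS]big_seq; apply: ler_sum => b.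
  rewrite mem_filter -leNgt => /andP[bd _].
  by rewrite [leRHS]mulrC ler_wpM2l//; exact: ltW.
have -> : d `^ (1 - p) = d / d `^ p.
  rewrite powRB; last by rewrite (gt_eqF d0) implybT.
  by rewrite powRr1// ltW.
rewrite -!mulrA ler_pM2l//.
rewrite [leRHS]mulrCA ler_pM2l// ler_pdivlMr ?powR_gt0// mulrC.
apply: gM; rewrite ?filter_uniq// => b.
by rewrite mem_filter => /andP[_ /td].
Qed.

End Weak.

Section Average.
Context {R : realType} (p : R) (p1 : 1 < p).

Definition avg (A B : Type) (f : A * nat -> B) (n : A -> nat) (g : B -> R)
    (a : A) :=
  (n a)%:R^-1 * \sum_(r <- iota 0 (n a)) g (f (a, r)).

Lemma big_part_avg (B : Type) (g : B -> R) (f : nat -> B) (n : nat) d :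
  (0 < n)%N -> 0 < d -> d * 2 < `|n%:R^-1 * \sum_(r <- iota 0 n) g (f r)| ->
  n%:R * d <= \sum_(r <- iota 0 n | d < `|g (f r)|) `|g (f r)|.
Proof.
move=> n0 d0; have n0' : 0 < n%:R :> R by rewrite ltr0n.
rewrite normrM normfV (gtr0_norm n0') ltr_pdivlMl// => /ltW.
move=> /le_trans/(_ (ler_norm_sum _ _ _)).
rewrite (bigID (fun r => d < `|g (f r)|))/= => h.
have {}h := le_trans h (lerD (lexx _) (_ : _ <= n%:R * d)).
suff : \sum_(i <- iota 0 n | ~~ (d < `|g (f i)|)) `|g (f i)| <= n%:R * d.
  by move=> /h; rewrite mulrA mulr_natr mulr2n lerD2r.
apply: (@le_trans _ _ (\sum_(i <- iota 0 n) d)); last first.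
  by rewrite big_const_seq count_predT size_iota iter_addr addr0 mulr_natl.
rewrite big_mkcond; apply: ler_sum => r _; case: ltP => //= _; exact: ltW.
Qed.

(** Where the average exceeds [2 * d], at least half of it comes from the part
of the function above [d], whose mass is controlled by [weak_bound_mass]. *)
Lemma bounded_avg (A B : eqType) (u : A -> R) (v : B -> R) (f : A * nat -> B)
    (n : A -> nat) (k : R) :
  0 < k -> (forall b, 0 < v b) -> injective f -> (forall a, (0 < n a)%N) ->
  (forall ar, v (f ar) * (n ar.1)%:R = k * u ar.1) ->
  bounded_op p v u (avg f n).
Proof.
move=> k0 v0 fI n0 vu; split.
  move=> h x y _ _; apply/funext => a; rewrite /avg big_split/= -mulr_sumr.
  by rewrite mulrDr mulrCA.
have [C C0 massC] := weak_bound_mass p1.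
exists (2 `^ p * (C / k)).
  by rewrite mulr_ge0 ?powR_ge0// divr_ge0// ltW.
move=> g M gM s c us c0 sg.
have -> : c = 2 * (c / 2) by rewrite mulrC divfK.
set d := c / 2; have d0 : 0 < d by rewrite divr_gt0.
rewrite powRM_gt0// -!mulrA ler_pM2l ?powR_gt0//.
pose t := [seq f ar | ar <- [seq (a, r) | a <- s, r <- iota 0 (n a)] &
                      d < `|g (f ar)|].
have ut : uniq t.
  rewrite map_inj_uniq// filter_uniq// allpairs_uniq_dep// => [a _|].
    exact: iota_uniq.
  by move=> [a r] [a' r'] _ _ /= [-> ->].
have tP b : b \in t -> d < `|g b|.
  by move=> /mapP[ar + ->]; rewrite mem_filter => /andP[].
have := massC _ _ _ _ _ _ v0 gM ut d0 tP.
have -> : d `^ (1 - p) = d / d `^ p.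
  rewrite powRB; last by rewrite (gt_eqF d0) implybT.
  by rewrite powRr1// ltW.
rewrite big_map big_filter big_mkcond big_allpairs_dep/=.
move=> h; have {h} : k * d * \sum_(a <- s) u a <= C * M * (d / d `^ p).
  apply: le_trans h; rewrite mulr_sumr [leLHS]big_seq [leRHS]big_seq.
  apply: ler_sum => a /sg ca; rewrite -big_mkcond/=.
  have va r : v (f (a, r)) = k * u a / (n a)%:R.
    by rewrite -(vu (a, r)) mulfK// pnatr_eq0 -lt0n.
  under eq_bigr do rewrite va.
  rewrite -mulr_sumr mulrAC -[X in _ <= X]mulrA ler_wpM2l//.
    by rewrite -(vu (a, 0%N)) mulr_ge0// ltW.
  rewrite ler_pdivlMl ?ltr0n//.
  apply: (big_part_avg (f := fun r => f (a, r))) => //.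
  by rewrite divfK.
rewrite [C * M * _]mulrCA [k * d * _]mulrAC [k * _ * d]mulrC ler_pM2l//.
rewrite ler_pdivlMr ?powR_gt0// => h; rewrite mulrA mulrAC ler_pdivlMr//.
by apply: le_trans h; rewrite le_eqVlt; apply/orP; left; apply/eqP; ring.
Qed.

End Average.

(** * Complemented subspaces and isomorphisms *)

Section Iso.
Context {R : realType} (p : R) (p1 : 1 < p).
Local Notation bounded_op := (bounded_op p).
Local Notation Lp := (Lp p).

Definition complemented (A B : eqType) (u : A -> R) (v : B -> R) :=
  exists J P,
    [/\ bounded_op u v J, bounded_op v u P & forall x, Lp u x -> P (J x) = x].

Definition iso (A B : eqType) (u : A -> R) (v : B -> R) :=
  exists T S, [/\ bounded_op u v T, bounded_op v u S,
    forall x, Lp u x -> S (T x) = x & forall y, Lp v y -> T (S y) = y].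

Lemma complemented_trans (A B C : eqType) (u : A -> R) (v : B -> R)
    (w : C -> R) :
  complemented u v -> complemented v w -> complemented u w.
Proof.
move=> [J [P [bJ bP PJ]]] [J' [P' [bJ' bP' PJ']]].
exists (J' \o J), (P \o P').
split; [exact: bounded_comp bJ' bJ|exact: bounded_comp bP bP'|].
by move=> x Lx /=; rewrite PJ' ?PJ//; exact: bounded_Lp bJ Lx.
Qed.

Lemma iso_sym (A B : eqType) (u : A -> R) (v : B -> R) : iso u v -> iso v u.
Proof. by move=> [T [S [? ? ? ?]]]; exists S, T. Qed.

Lemma iso_trans (A B C : eqType) (u : A -> R) (v : B -> R) (w : C -> R) :
  iso u v -> iso v w -> iso u w.
Proof.
move=> [J [P [bJ bP PJ JP]]] [J' [P' [bJ' bP' PJ' JP']]].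
exists (J' \o J), (P \o P').
split; [exact: bounded_comp bJ' bJ|exact: bounded_comp bP bP'| |].
  by move=> x Lx /=; rewrite PJ' ?PJ//; exact: bounded_Lp bJ Lx.
by move=> x Lx /=; rewrite JP ?JP'//; exact: bounded_Lp bP' Lx.
Qed.

Lemma iso_bij (A B : eqType) (u : A -> R) (v : B -> R) (f : A -> B) (g : B -> A)
    (K : R) :
  0 <= K -> (forall a, 0 < u a) -> (forall b, 0 < v b) ->
  cancel f g -> cancel g f ->
  (forall a, u a <= K * v (f a)) -> (forall a, v (f a) <= K * u a) ->
  iso u v.
Proof.
move=> K0 u0 v0 fK gK uv vu.
exists (pull (fun b => Some (g b))), (pull (fun a => Some (f a))); split.
- apply: (bounded_pull_inj _ K0) => //.
    by move=> b b' a [<-] [] /(can_inj gK).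
  move=> b a [<-].
  by rewrite -{1}(gK b).
- apply: (bounded_pull_inj _ K0) => // [b b' a [<-] [] /(can_inj fK)//|].
  by move=> b a [<-].
- by move=> x _; apply/funext => a; rewrite /pull fK.
- by move=> x _; apply/funext => a; rewrite /pull gK.
Qed.

Definition wsum (A B : Type) (u : A -> R) (v : B -> R) (x : A + B) :=
  match x with inl a => u a | inr b => v b end.

Section Sum.
Variables (A B : eqType) (u : A -> R) (v : B -> R).
Hypotheses (u0 : forall a, 0 < u a) (v0 : forall b, 0 < v b).

Lemma wsum_gt0 x : 0 < wsum u v x.
Proof. by case: x. Qed.

Lemma bounded_inl : bounded_op (wsum u v) u (fun z a => z (inl a)).
Proof.
apply: (bounded_pull_inj (f := fun a => Some (inl a)) _ ler01) => //.
- exact: wsum_gt0.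
- by move=> b b' a [<-] [].
- by move=> b a [<-]; rewrite mul1r.
Qed.

Lemma bounded_inr : bounded_op (wsum u v) v (fun z a => z (inr a)).
Proof.
apply: (bounded_pull_inj (f := fun a => Some (inr a)) _ ler01) => //.
- exact: wsum_gt0.
- by move=> b b' a [<-] [].
- by move=> b a [<-]; rewrite mul1r.
Qed.

Lemma bounded_case (C : eqType) (w : C -> R) T S :
  bounded_op w u T -> bounded_op w v S ->
  bounded_op w (wsum u v) (fun x => sum_rect (fun=> R) (T x) (S x)).
Proof.
move=> bT bS.
pose i := @pull R A (A + B) (fun x => if x is inl a then Some a else None).
pose j := @pull R B (A + B) (fun x => if x is inr a then Some a else None).
have bi : bounded_op u (wsum u v) i.
  apply: (bounded_pull_inj _ ler01) => // [[b|//] [b'|//] a [->] [->]//|].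
  by move=> [b|//] a [->]; rewrite mul1r.
have bj : bounded_op v (wsum u v) j.
  apply: (bounded_pull_inj _ ler01) => // [[//|b] [//|b'] a [->] [->]//|].
  by move=> [//|b] a [->]; rewrite mul1r.
have := bounded_lin 1 wsum_gt0 (bounded_comp bi bT) (bounded_comp bj bS).
congr bounded_op; apply/funext => x; apply/funext => -[a|b] /=.
  by rewrite /i /j /pull mul1r addr0.
by rewrite /i /j /pull mulr0 add0r.
Qed.

End Sum.

Lemma iso_sum (A B A' B' : eqType) (u : A -> R) (v : B -> R) (u' : A' -> R)
    (v' : B' -> R) :
  (forall a, 0 < u a) -> (forall a, 0 < v a) ->
  (forall a, 0 < u' a) -> (forall a, 0 < v' a) ->
  iso u u' -> iso v v' -> iso (wsum u v) (wsum u' v').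
Proof.
move=> u0 v0 u0' v0' [J [P [bJ bP PJ JP]]] [J' [P' [bJ' bP' PJ' JP']]].
have bl := bounded_inl u0 v0; have br := bounded_inr u0 v0.
have bl' := bounded_inl u0' v0'; have br' := bounded_inr u0' v0'.
eexists; eexists; split.
- exact: (bounded_case u0' v0' (bounded_comp bJ bl) (bounded_comp bJ' br)).
- exact: (bounded_case u0 v0 (bounded_comp bP bl') (bounded_comp bP' br')).
- move=> x Lx; apply/funext => -[a|a] /=.
    by rewrite PJ//; exact: bounded_Lp bl Lx.
  by rewrite PJ'//; exact: bounded_Lp br Lx.
- move=> x Lx; apply/funext => -[a|a] /=.
    by rewrite JP//; exact: bounded_Lp bl' Lx.
  by rewrite JP'//; exact: bounded_Lp br' Lx.
Qed.

Lemma iso_sumC (A B : eqType) (u : A -> R) (v : B -> R) :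
  (forall a, 0 < u a) -> (forall a, 0 < v a) -> iso (wsum u v) (wsum v u).
Proof.
move=> u0 v0.
apply: (@iso_bij _ _ _ _
  (fun x => match x with inl a => inr a | inr a => inl a end)
  (fun x => match x with inl a => inr a | inr a => inl a end) 1) => //;
  try exact: wsum_gt0; by case=> //= a; rewrite mul1r.
Qed.

(** Inside [v], the shift [s] makes room for one more summand among the
countably many complemented copies of [u]; the complementary subspace is left
fixed. *)
Lemma iso_absorb (A B : eqType) (u : A -> R) (v : B -> R) :
  (forall a, 0 < u a) -> (forall b, 0 < v b) ->
  complemented (fun x : A * nat => u x.1) v -> iso (wsum v u) v.
Proof.
move=> u0 v0 [J [P [bJ bP PJ]]].
pose U (x : A * nat) := u x.1.
have U0 a : 0 < U a by exact: u0.
pose s := @pull R (A * nat + A) (A * nat) (fun x => Some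
  (match x.2 with 0%N => inr x.1 | n.+1 => inl (x.1, n) end)).
have bs : bounded_op (wsum U u) U s.
  apply: (bounded_pull_inj _ ler01) => //; first exact: wsum_gt0.
    by move=> [a [|n]] [b [|m]] c [<-] [] //= -> // ->.
  by move=> [a [|n]] c [<-]; rewrite mul1r.
pose up (f : A * nat -> R) (x : A * nat) := f (x.1, x.2.+1).
pose bot (f : A * nat -> R) (a : A) := f (a, 0%N).
have bup : bounded_op U U up.
  apply: (bounded_pull_inj
    (f := fun x : A * nat => Some (x.1, x.2.+1)) _ ler01) => //.
    by move=> [a n] [b m] c [<-] [-> ->].
  by move=> [a n] c [<-]; rewrite mul1r.
have bbot : bounded_op U u bot.
  apply: (bounded_pull_inj (f := fun x : A => Some (x, 0%N)) _ ler01) => //.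
    by move=> a b c [<-] [->].
  by move=> a c [<-]; rewrite mul1r.
have bl := bounded_inl v0 u0; have br := bounded_inr v0 u0.
have bt := bounded_comp bs (bounded_case U0 u0 (bounded_comp bP bl) br).
have sE f x : s (sum_rect (fun=> R) f x) = fun a =>
    if a.2 is n.+1 then f (a.1, n) else x a.1.
  by apply/funext => -[a [|n]].
pose Q g := fun b => -1 * J (P g) b + g b.
have bQ : bounded_op v v Q.
  exact: bounded_lin _ v0 (bounded_comp bJ bP) (bounded_id _ _).
(* [Q] projects onto the kernel of [P], so that [J t + Q g] replaces by [t] the
   component of [g] in the complemented subspace *)
have PQ g t : Lp v g -> Lp U t -> P (fun b => 1 * J t b + Q g b) = t.
  move=> Lg Lt; rewrite (bP.1 _ _ _ (bounded_Lp bJ Lt) (bounded_Lp bQ Lg)) PJ//.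
  rewrite (bP.1 _ _ _ (bounded_Lp bJ (bounded_Lp bP Lg)) Lg) PJ//.
    by apply/funext => b; ring.
  exact: bounded_Lp bP Lg.
have QQ g t : Lp v g -> Lp U t -> Q (fun b => 1 * J t b + Q g b) = Q g.
  move=> Lg Lt; rewrite {1}/Q PQ//; apply/funext => b; ring.
pose l (z : B + A -> R) b := z (inl b).
pose t (z : B + A -> R) :=
  s (sum_rect (fun=> R) (P (l z)) (fun a => z (inr a))).
pose T z := fun b => 1 * J (t z) b + Q (l z) b.
pose S y :=
  sum_rect (fun=> R) (fun b => 1 * J (up (P y)) b + Q y b) (bot (P y)).
exists T, S; split.
- exact: (bounded_lin 1 v0 (bounded_comp bJ bt) (bounded_comp bQ bl)).
- exact: (bounded_case v0 u0
    (bounded_lin 1 v0 (bounded_comp bJ (bounded_comp bup bP)) bQ)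
    (bounded_comp bbot bP)).
- move=> z Lz; have Ll : Lp v (l z) := bounded_Lp bl Lz.
  have Lt : Lp U (t z) := bounded_Lp bt Lz.
  have PT : P (T z) = t z by exact: PQ.
  have QT : Q (T z) = Q (l z) by exact: QQ.
  apply/funext => -[b|a]; rewrite /S /= PT; last by rewrite /bot /t sE.
  have -> : up (t z) = P (l z) by rewrite /t sE; apply/funext => -[].
  by rewrite QT /Q -[z (inl b)]/(l z b); ring.
- move=> g Lg; have Lu : Lp U (up (P g)) := bounded_Lp bup (bounded_Lp bP Lg).
  have PS : P (l (S g)) = up (P g) by exact: PQ.
  have QS : Q (l (S g)) = Q g by exact: QQ.
  apply/funext => b; rewrite /T QS /t PS sE.
  have -> : (fun a : A * nat => match a.2 with 0%N => S g (inr a.1)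
      | n.+1 => up (P g) (a.1, n) end) = P g by apply/funext => -[a [|n]].
  by rewrite /Q; ring.
Qed.

(** The atom [a] is split into the [n a] atoms [f (a, r)], [r < n a], of equal
weight; the factor [k] changes the quasi-norm by a constant factor only. *)
Lemma complemented_split (A B : eqType) (u : A -> R) (v : B -> R)
    (f : A * nat -> B) (n : A -> nat) (k : R) :
  0 < k -> (forall a, 0 < u a) -> (forall b, 0 < v b) -> injective f ->
  (forall a, (0 < n a)%N) ->
  (forall ar, v (f ar) * (n ar.1)%:R = k * u ar.1) ->
  complemented u v.
Proof.
move=> k0 u0 v0 fI n0 vu.
pose in_fibre b := fun ar : A * nat => (ar.2 < n ar.1)%N /\ f ar = b.
pose g b : option A :=
  if pselect (exists ar, in_fibre b ar) is left h
  then Some (projT1 (cid h)).1 else None.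
have gf a r : (r < n a)%N -> g (f (a, r)) = Some a.
  move=> ra; rewrite /g; case: pselect => [h|[]]; last by exists (a, r).
  by case: (cid h) => -[a' r'] /= [_ /fI[-> _]].
have gS b a : g b = Some a -> exists2 r, (r < n a)%N & b = f (a, r).
  rewrite /g; case: pselect => // h [<-].
  case: (cid h) => -[a' r'] /= [r'a' <-].
  by exists r'.
exists (pull g), (avg f n); split.
- apply: (bounded_pull _ (ltW k0)) => a s us sa.
  have va r : v (f (a, r)) = k * u a / (n a)%:R.
    by rewrite -(vu (a, r)) mulfK// pnatr_eq0 -lt0n.
  have -> : \sum_(b <- s) v b = \sum_(b <- s) k * u a / (n a)%:R.
    by apply: eq_big_seq => b /sa/gS[r _ ->].
  rewrite big_const_seq count_predT iter_addr addr0 -[leLHS]mulr_natl.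
  rewrite mulrCA ler_piMr//; first by rewrite mulr_ge0// ltW.
  rewrite ler_pdivrMr ?ltr0n// mul1r ler_nat.
  rewrite -[leqRHS](size_iota 0) -(size_map (fun r => f (a, r))).
  apply: uniq_leq_size us _ => b /sa/gS[r ra ->].
  by apply: map_f; rewrite mem_iota.
- exact: bounded_avg k0 v0 fI n0 vu.
- move=> x _; apply/funext => a; rewrite /avg.
  rewrite (eq_big_seq (fun=> x a)); last first.
    by move=> r; rewrite mem_iota add0n => /= ra; rewrite /pull gf.
  rewrite big_const_seq count_predT size_iota iter_addr addr0.
  rewrite -[X in _ * X]mulr_natl mulKf//.
  by rewrite pnatr_eq0 -lt0n.
Qed.

End Iso.

(** * Weights that are powers of two *)

Section Levels.
Context {R : realType} (p : R) (p1 : 1 < p).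
Local Notation bounded_op := (bounded_op p).
Local Notation Lp := (Lp p).

Definition pow2 (A : Type) (L : A -> int) (a : A) : R := 2 ^ L a.

Lemma pow2_gt0 (A : Type) (L : A -> int) a : 0 < pow2 L a.
Proof. exact: exprz_gt0. Qed.

(** Together with its levels, the set of atoms is equivalent to countably many
copies of itself; this is the form in which [iso_absorb] can be used. *)
Definition stable (A : Type) (L : A -> int) :=
  exists h : A * nat -> A, injective h /\ forall x, L (h x) = L x.1.

Definition level_emb (A B : Type) (LA : A -> int) (LB : B -> int) :=
  exists (K : int) (f : A -> B * nat),
    injective f /\ forall a, LB (f a).1 <= LA a + K.

(** Up to the shift [K], an atom is split into atoms of the level of its image;
stability provides the atoms needed, for countably many copies at once. *)
Lemma complemented_level_emb (A B : eqType) (LA : A -> int) (LB : B -> int) :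
  stable LB -> level_emb LA LB ->
  complemented p (fun x : A * nat => pow2 LA x.1) (pow2 LB).
Proof.
move=> [h [hI Lh]] [K [f [fI fL]]].
pose n (x : A * nat) := (2 ^ absz (LA x.1 + K - LB (f x.1).1)%R)%N.
pose g (x : A * nat * nat) := h ((f x.1.1).1, pickle ((f x.1.1).2, x.1.2, x.2)).
apply: (@complemented_split _ p p1 _ _ _ _ g n (2 ^ K)).
- exact: exprz_gt0.
- by move=> a; exact: pow2_gt0.
- exact: pow2_gt0.
- move=> [[a i] r] [[a' i'] r'] /hI[e /(pcan_inj pickleK)[e' -> ->]].
  by congr (_, _, _); apply/fI/injective_projections.
- by move=> a; rewrite expn_gt0.
- move=> [[a i] r]; rewrite /g /pow2 Lh /n /= natrX exprnP abszE ger0_norm.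
    by rewrite -!expfzDr ?pnatr_eq0//; congr (_ ^ _); lia.
  by rewrite subr_ge0 fL.
Qed.

(** Each of the two spaces absorbs the other, hence both are isomorphic to their
sum. *)
Lemma iso_level_emb (A B : eqType) (LA : A -> int) (LB : B -> int) :
  stable LA -> stable LB -> level_emb LA LB -> level_emb LB LA ->
  iso p (pow2 LA) (pow2 LB).
Proof.
move=> sA sB AB BA; have a0 := pow2_gt0 LA; have b0 := pow2_gt0 LB.
apply: iso_trans (iso_sym (iso_absorb b0 a0 (complemented_level_emb sA BA))) _.
apply: iso_trans (iso_sumC p a0 b0) _.
exact: iso_absorb a0 b0 (complemented_level_emb sB AB).
Qed.

Lemma complemented_inj (A B : eqType) (u : A -> R) (v : B -> R) (e : A -> B)
    (K : R) :
  0 <= K -> (forall a, 0 < u a) -> (forall b, 0 < v b) -> injective e ->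
  (forall a, u a <= K * v (e a)) -> (forall a, v (e a) <= K * u a) ->
  complemented p u v.
Proof.
move=> K0 u0 v0 eI uv vu.
pose g b :=
  if pselect (exists a, e a = b) is left h then Some (projT1 (cid h)) else None.
have ge a : g (e a) = Some a.
  rewrite /g; case: pselect => [h|[]]; last by exists a.
  by case: (cid h) => a' /= /eI ->.
have gS b a : g b = Some a -> b = e a.
  by rewrite /g; case: pselect => // h [<-]; case: (cid h).
exists (pull g), (pull (fun a => Some (e a))); split.
- by apply: (bounded_pull_inj _ K0) => // [b b' a /gS -> /gS ->|b a /gS ->].
- by apply: (bounded_pull_inj _ K0) => // [b b' a [<-] [] /eI|b a [<-]].
- by move=> x _; apply/funext => a; rewrite /pull ge.
Qed.

(** * Countable sets of atoms *)

(** By compactness of bounded intervals, any ultrafilter finer than [\oo] will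
do. *)
Lemma ultralimit : exists U : set_system nat, [/\ ProperFilter U, \oo `<=` U &
  forall (y : nat -> R) B, (forall n, `|y n| <= B) -> cvg (y @ U)].
Proof.
have [U [UU oU]] := @ultraFilterLemma nat \oo _.
exists U; split => [||y B yB]; [exact: ultra_proper|exact: oU|].
have UP : ProperFilter U by exact: ultra_proper.
have yUP := fmap_proper_filter y UP.
have [|q [_ cq]] := @segment_compact R (- B) B (y @ U) yUP.
  by apply: (@filterE _ U) => n; rewrite /= in_itv/= -ler_norml.
apply/cvg_ex; exists q => V qV.
have [//|nV] := in_ultra_setVsetC (y @^-1` V) UU.
by have [z [nVz Vz]] := cq (~` V) V nV qV.
Qed.

Lemma seq_argmax (A : eqType) (f : A -> nat) (s : seq A) : s != [::] ->
  exists2 z, z \in s & forall z', z' \in s -> (f z' <= f z)%N.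
Proof.
elim: s => // z [|y s] IH _.
  by exists z; rewrite ?mem_head// => z'; rewrite inE => /eqP ->.
have [//|t ts tmax] := IH; have [tz|zt] := leqP (f t) (f z).
  exists z; rewrite ?mem_head// => z'; rewrite inE => /orP[/eqP ->//|/tmax].
  by move=> /leq_trans; apply.
exists t; first by rewrite inE ts orbT.
by move=> z'; rewrite inE => /orP[/eqP ->|/tmax//]; exact: ltnW.
Qed.

Lemma ler_sum_subseq (A : eqType) (f : A -> R) (s t : seq A) :
  (forall a, 0 <= f a) -> uniq s -> uniq t -> {subset s <= t} ->
  \sum_(a <- s) f a <= \sum_(a <- t) f a.
Proof.
move=> f0 us ut st; have sE : perm_eq s [seq a <- t | a \in s].
  apply: uniq_perm => //; first exact: filter_uniq.
  by move=> a; rewrite mem_filter; case: (boolP (a \in s)) => // /st ->.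
rewrite (perm_big _ sE) big_filter [leRHS](bigID (mem s))/= lerDl.
exact: sumr_ge0.
Qed.

Section Nat.
Variable L : nat -> int.

Let b n := (\sum_(i < n.+1) `|L i|)%N.

(** The weights of the [n]-th block, whose atoms are the pairs [(i, n)] with
[i < n], are multiplied by [2 ^+ blk n].  The growth of [blk] makes these
weights integers and the blocks lacunary. *)
Fixpoint blk (n : nat) := if n is m.+1 then (blk m + b m + b n + m)%N else b 0.
Definition blk_level (x : nat * nat) : int :=
  if (x.1 < x.2)%N then L x.1 + blk x.2 else 0.

Let le_b i n : (i <= n)%N -> (`|L i| <= b n)%N.
Proof.
rewrite -ltnS => i_n; rewrite /b (bigD1 (Ordinal i_n))//=.
exact: leq_addr.
Qed.

Let b_blk n : (b n <= blk n)%N.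
Proof. by case: n => //= n; rewrite -addnA addnCA leq_addr. Qed.

Let blk_level_ge0 x : 0 <= blk_level x.
Proof.
rewrite /blk_level; case: ltnP => // /ltnW/le_b h; have := b_blk x.2; lia.
Qed.

(** One atom outweighs all previous blocks together, by induction on
[S n <= 2 ^+ (blk n - b n)]. *)
Lemma blk_lacunary i n : (i < n)%N ->
  \sum_(0 <= m < n) \sum_(0 <= j < m) pow2 blk_level (j, m) <=
    pow2 blk_level (i, n).
Proof.
move=> i_n.
pose S n := \sum_(0 <= m < n) \sum_(0 <= j < m) pow2 blk_level (j, m).
suff Sn : S n <= 2 ^+ (blk n - b n).
  apply: le_trans Sn _.
  rewrite /pow2 /blk_level i_n exprnP ler_weXz2l ?ler1n//=.
  have := le_b (ltnW i_n); have := b_blk n; lia.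
elim: n {i_n} => [|n IH]; first by rewrite /S big_geq// exprn_ge0.
rewrite /S big_nat_recr//= -/(S n).
apply: (@le_trans _ _ ((2 ^+ (blk n + b n)) *+ n.+1)); last first.
  rewrite -mulr_natl (@le_trans _ _ (2 ^+ n * 2 ^+ (blk n + b n)))//.
    by rewrite ler_wpM2r ?exprn_ge0// -natrX ler_nat ltn_expl.
  rewrite -exprD ler_eXn2l ?ltr1n//; lia.
rewrite mulrS lerD//.
  apply: le_trans IH _; rewrite ler_eXn2l ?ltr1n//; lia.
rewrite -[X in _ *+ X]subn0 -sumr_const_nat; apply: ler_sum_nat => j /= jn.
rewrite /pow2 /blk_level jn exprnP ler_weXz2l ?ler1n//=.
have := le_b (ltnW jn); lia.
Qed.

(* compensates for the factor [2 ^+ blk n] in the quasi-norm *)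
Let lam n : R := 2 `^ (- (blk n)%:R / p).

Let lam_gt0 n : 0 < lam n. Proof. by rewrite powR_gt0. Qed.

Let lamE n : lam n `^ p = (2 ^+ blk n)^-1.
Proof.
by rewrite /lam -powRrM divfK ?gt_eqF ?(lt_trans ltr01)// powRN powR_mulrn.
Qed.

Let blk_wt i n : (i < n)%N -> pow2 blk_level (i, n) = 2 ^+ blk n * pow2 L i.
Proof.
by move=> i_n; rewrite /pow2 /blk_level i_n/= expfzDr// mulrC exprnP.
Qed.

Definition blk_in (x : nat -> R) (z : nat * nat) :=
  if (z.1 < z.2)%N then lam z.2 * x z.1 else 0.

(** Let [N] be the last block that meets a given set where the image of [x] is
large.  Within this block the measure is controlled by [x] itself, and all the
previous blocks together weigh less than one of its atoms. *)
Lemma bounded_blk_in : bounded_op (pow2 L) (pow2 blk_level) blk_in.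
Proof.
split.
  move=> k x y _ _; apply/funext => -[i n]; rewrite /blk_in/=.
  by case: ltnP => _; ring.
exists 2 => // x M xM s c us c0 sx.
have sP z : z \in s -> (z.1 < z.2)%N /\ c / lam z.2 < `|x z.1|.
  move=> /sx; rewrite /blk_in; case: ltnP => _; last first.
    by rewrite normr0 => /(lt_trans c0); rewrite ltxx.
  by rewrite normrM gtr0_norm// ltr_pdivrMr// mulrC.
have cE n : c `^ p * 2 ^+ blk n = (c / lam n) `^ p.
  have -> : c `^ p = (c / lam n) `^ p * lam n `^ p.
    by rewrite -powRM_gt0 ?divr_gt0// divfK// lt0r_neq0.
  by rewrite lamE divfK// expf_neq0.
have xz z : z \in s -> c `^ p * pow2 blk_level z <= M.
  case: z => i n /sP[/= i_n ci]; rewrite blk_wt// mulrA cE.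
  have := xM [:: i] _ isT (divr_gt0 c0 (lam_gt0 n)).
  rewrite big_seq1; apply=> j.
  by rewrite inE => /eqP ->.
have [->|/(@seq_argmax _ snd)[[i N] iNs Nmax]] := eqVneq s [::].
  by rewrite big_nil mulr0 mulr_ge0// (weak_bound_ge0 xM).
rewrite (bigID (fun z => z.2 == N))/= mulrDr mulrDl mul1r lerD//.
  rewrite -big_filter; set s1 := seq.filter _ s.
  have s1P z : z \in s1 -> [/\ z.2 = N, (z.1 < N)%N & c / lam N < `|x z.1|].
    by rewrite mem_filter => /andP[/eqP <- /sP[]].
  rewrite (eq_big_seq (fun z => 2 ^+ blk N * pow2 L z.1)); last first.
    by move=> [j m] /s1P[/= -> jN _]; rewrite blk_wt.
  rewrite -mulr_sumr mulrA cE -(big_map fst xpredT (pow2 L)).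
  apply: xM; [|exact: divr_gt0|by move=> _ /mapP[z /s1P[]] ? ? ? ->].
  rewrite map_inj_in_uniq ?filter_uniq// => -[j m] [j' m'].
  by move=> /s1P[/= -> _ _] /s1P[/= -> _ _] ->.
apply: le_trans (xz _ iNs); rewrite ler_wpM2l ?powR_ge0//.
apply: le_trans (blk_lacunary (sP _ iNs).1).
rewrite -big_filter -(big_allpairs_dep (h := fun m j : nat => (j, m))).
apply: ler_sum_subseq => [z|||]; first exact/ltW/pow2_gt0.
- exact: filter_uniq.
- by apply: allpairs_uniq_dep => [|m _|[j m] [j' m'] _ _ /= [-> ->]//];
    exact: iota_uniq.
- move=> [j m]; rewrite mem_filter => /andP[/= mN zs].
  have [/= jm _] := sP _ zs; apply/allpairsPdep; exists m, j; split => //.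
    by rewrite mem_index_iota/= ltn_neqAle mN (Nmax _ zs).
  by rewrite mem_index_iota.
Qed.
(** The limit along the ultrafilter of the rescaled blocks is a left inverse of
[blk_in].  It is bounded since the strict inequalities on finitely many atoms
which express that the limit is large already hold for one of the blocks. *)
Lemma complemented_nat : complemented p (pow2 L) (fun _ : nat => 1 : R).
Proof.
have w0 := pow2_gt0 L; have w0' := pow2_gt0 blk_level.
apply: (@complemented_trans _ _ _ _ _ _ (pow2 blk_level)); last first.
  apply: (@complemented_split _ p p1 _ _ _ _ (@pickle (nat * nat * nat)%type)
    (fun x => 2 ^ `|blk_level x|)%N 1) => //.
  - by move=> x; rewrite expn_gt0.
  - move=> [x r]/=; rewrite !mul1r /pow2 natrX exprnP.
    by rewrite gez0_abs ?blk_level_ge0.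
have [U [UF oU Ucvg]] := ultralimit.
pose y (g : nat * nat -> R) (i n : nat) :=
  if (i < n)%N then (lam n)^-1 * g (i, n) else 0.
pose P g i := lim (y g i @ U).
have yP g i : Lp (pow2 blk_level) g -> y g i @ U --> P g i.
  move=> [M gM]; pose B := 1 + 2 `^ p * M / pow2 L i.
  apply: (Ucvg _ B) => n; rewrite /y; case: ltnP => i_n; last first.
    rewrite normr0 addr_ge0// divr_ge0//.
      by rewrite mulr_ge0 ?powR_ge0 ?(weak_bound_ge0 gM).
    exact: ltW.
  rewrite normrM normfV (gtr0_norm (lam_gt0 n)).
  have := weak_bound1 p1 (i, n) gM; rewrite blk_wt// mulrA -ler_pdivlMr//.
  set a := _ * `|_|; have a0 : 0 <= a by rewrite mulr_ge0// invr_ge0 ltW.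
  have -> : `|g (i, n)| `^ p * 2 ^+ blk n = a `^ p.
    have -> : `|g (i, n)| = a * lam n by rewrite mulrC mulVKf// lt0r_neq0.
    by rewrite (powRM _ a0 (ltW (lam_gt0 n))) lamE divfK// expf_neq0.
  move=> /(lerD (lexx 1)); apply: le_trans.
  have [a1|a1] := leP a 1; first by rewrite (le_trans a1)// lerDl powR_ge0.
  by rewrite (le_trans (le1r_powR (ltW a1) (ltW p1)))// lerDr.
exists blk_in, P; split.
- exact: bounded_blk_in.
- split.
    move=> k f g Lf Lg; apply/funext => i.
    apply: cvg_lim => //.
    have -> : y (fun a => k * f a + g a) i = (fun n => k * y f i n) + y g i.
      apply/funext => n; rewrite /y -[RHS]/(_ + _); case: ltnP => _; ring.
    apply: cvgD (yP _ _ Lg); apply: cvgMl_tmp; exact: yP.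
  exists 1 => // g M gM; rewrite mul1r => s c us c0 sg.
  have gL : Lp (pow2 blk_level) g by exists M.
  have Us : U [set n | forall i, i \in s -> c < `|y g i n|].
    elim: s {us} sg => [|i s IH] sg; first exact: filterE.
    have h1 : U [set n | c < `|y g i n|].
      have yi : `|y g i n| @[n --> U] --> `|P g i|.
        by apply: cvg_norm; exact: yP.
      by apply: (cvgr_gt _ yi); exact: sg (mem_head _ _).
    have h2 : U [set n | forall j, j \in s -> c < `|y g j n|].
      by apply: IH => j js; apply: sg; rewrite inE js orbT.
    apply: filterS (filterI h1 h2) => n [/= h hs] j.
    by rewrite inE => /orP[/eqP ->//|/hs].
  have [n /= ns] := filter_ex Us.
  have nsP i : i \in s -> (i < n)%N /\ c * lam n < `|g (i, n)|.
    move=> /ns; rewrite /y; case: ltnP => // _; last first.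
      by rewrite normr0 => /(lt_trans c0); rewrite ltxx.
    by rewrite normrM normfV (gtr0_norm (lam_gt0 n)) ltr_pdivlMl// mulrC.
  have := gM [seq (i, n) | i <- s] (c * lam n).
  rewrite map_inj_uniq => [/(_ us)|i j [->]//].
  rewrite mulr_gt0// => /(_ isT).
  rewrite powRM_gt0// lamE big_map.
  rewrite (eq_big_seq (fun i => 2 ^+ blk n * pow2 L i)); last first.
    by move=> i /nsP[i_n _]; rewrite blk_wt.
  rewrite -mulr_sumr -mulrA mulKf ?expf_neq0//; apply.
  by move=> _ /mapP[i /nsP[_ h] ->].
- move=> x _; apply/funext => i; apply: cvg_lim => //.
  apply: cvg_near_cst; apply: oU; exists i.+1 => // n /= i_n.
  by rewrite /y /blk_in/= i_n mulKf// lt0r_neq0.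
Qed.

End Nat.

End Levels.

Lemma infinite_level (A : Type) (L : A -> int) : ~ emb A nat ->
  exists m (e : nat -> A), injective e /\ forall n, L (e n) = m.
Proof.
move=> uA; apply: contrapT => nA; apply: uA.
have fin m : ~ emb nat [set a | L a = m].
  move=> [e eI]; apply: nA; exists m, (val \o e); split.
    exact: inj_comp val_inj eI.
  by move=> n; have /set_mem := valP (e n).
pose c m := projT1 (cid (not_infinite_nat (fin m))).
have cI m : forall x y, L x = m -> L y = m -> c m x = c m y -> x = y.
  exact: projT2 (cid (not_infinite_nat (fin m))).
exists (fun a => pickle (L a, c (L a) a)) => a b /(pcan_inj pickleK)[Lab].
by rewrite -Lab; exact: cI.
Qed.

Section Absorb.
Context {R : realType} (p : R) (p1 : 1 < p).
Local Notation pow2 := (@pow2 R _).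

(** An uncountable set of atoms has an infinite level, so that the space of
countably many atoms of weight one is complemented; by [complemented_nat] so is
the space of any countable set of atoms. *)
Lemma iso_countable (A C : eqType) (L : A -> int) (M : C -> int) :
  emb C nat -> ~ emb A nat -> iso p (wsum (pow2 L) (pow2 M)) (pow2 L).
Proof.
move=> cC /infinite_level-/(_ L)[m [a [aI aL]]].
have w0 (B : Type) (N : B -> int) b : 0 < pow2 N b by exact: pow2_gt0.
apply: iso_absorb => //.
have [e eI] : emb (C * nat) nat.
  exact: emb_trans (emb_prod cC (emb_refl _)) (emb_countType _).
have [N Ne] : exists N : nat -> int, forall x, N (e x) = M x.1.
  exists (fun n => if pselect (exists x, e x = n) is left h
    then M (projT1 (cid h)).1 else 0) => x.
  case: pselect => [h|[]]; last by exists x.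
  by case: (cid h) => y /= /eI ->.
apply: (@complemented_trans _ _ _ _ _ _ (pow2 N)).
  have wE x : pow2 N (e x) = pow2 M x.1 by rewrite /pow2 Ne.
  by apply: (@complemented_inj _ _ _ _ _ _ e 1) => // x; rewrite mul1r wE.
apply: (complemented_trans (complemented_nat p1 N)).
have m0 : 0 < (2 : R) ^ m by exact: exprz_gt0.
apply: (@complemented_inj _ _ _ _ _ _ a (2 ^ m + (2 ^ m)^-1)) => //.
- by rewrite addr_ge0// ?invr_ge0 ltW.
- by move=> n; rewrite /pow2 aL mulrDl mulVf ?gt_eqF// lerDr mulr_ge0// ltW.
- by move=> n; rewrite /pow2 aL mulr1 lerDl invr_ge0 ltW.
Qed.

End Absorb.

(** * Stable families of atoms *)

Lemma stable_levels (A : Type) (L : A -> int) :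
  (forall m, emb ([set a | L a = m] * nat) [set a | L a = m]) -> stable L.
Proof.
move=> H; pose h m := projT1 (cid (H m)).
have hI m : injective (h m) := projT2 (cid (H m)).
pose g (x : A * nat) :=
  val (h (L x.1) (SigSub (mem_set (erefl : [set a | L a = L x.1] x.1)), x.2)).
have gE m a i (e : L a = m) :
    g (a, i) = val (h m (SigSub (mem_set (e : [set a | L a = m] a)), i)).
  by case: m / e.
have gL x : L (g x) = L x.1.
  by case: x => a i; rewrite /g/=; case: (h _ _) => b /= /set_mem.
exists g; split=> // -[a i] [b j] gab.
have Lab : L a = L b by have := congr1 L gab; rewrite !gL.
move: gab; rewrite (gE _ _ _ Lab) (gE _ _ _ (erefl (L b))).
by move=> /val_inj/hI[-> ->].
Qed.

Lemma stable_sub (A : Type) (L : A -> int) (P : int -> Prop) :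
  stable L -> stable (fun x : [set a | P (L a)] => L (val x)).
Proof.
move=> [h [hI hL]].
have hP (x : [set a | P (L a)] * nat) : P (L (h (val x.1, x.2))).
  by rewrite hL; exact: set_mem (valP x.1).
exists (fun x => SigSub (mem_set (hP x : [set a | P (L a)] _))); split.
  move=> [a i] [b j] /(congr1 val)/hI[ab ->]; congr pair; exact: val_inj.
by move=> x; rewrite /= hL.
Qed.

Definition thin (A : Type) (L : A -> int) :=
  [set a | emb [set b | L b = L a] nat].

Lemma thin_countable (A : Type) (L : A -> int) : emb (thin L) nat.
Proof.
have ct m : exists f : A -> nat, forall a b, (thin L) a -> L a = m -> L b = m ->
    f a = f b -> a = b.
  have [[f fI]|n] := pselect (emb [set b | L b = m] nat); last first.
    by exists (fun=> 0%N) => a b ta Lam; case: n; rewrite -Lam.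
  exists (fun a => if pselect (L a = m) is left e
    then f (SigSub (mem_set (e : [set a | L a = m] a))) else 0%N).
  move=> a b _ La Lb.
  by do 2 case: pselect => // ?; move=> /fI/(congr1 val).
pose c m := projT1 (cid (ct m)).
exists (fun a => pickle (L (val a), c (L (val a)) (val a))) => a b.
move=> /(pcan_inj pickleK)[Lab cab]; apply: val_inj.
apply: (projT2 (cid (ct (L (val b))))) => //; first exact: set_mem (valP a).
by rewrite -/(c _) -cab Lab.
Qed.

(** A level that remains is uncountable, and [emb_prod_nat] applies to it. *)
Lemma stable_thick (A : Type) (L : A -> int) :
  stable (fun x : ~` thin L => L (val x)).
Proof.
apply: stable_levels => m.
have [[x xm]|nm] := pselect ([set a : ~` thin L | L (val a) = m] !=set0);
  last first.
  exists fst => -[x i]; case: nm; exists (val x); exact: set_mem (valP x).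
apply/emb_prod_nat/uncountable_infinite; apply: contra_not (set_mem (valP x)).
apply: emb_trans.
have th (b : [set b | L b = L (val x)]) : (~` thin L) (val b).
  by rewrite /thin /= (set_mem (valP b)); exact: set_mem (valP x).
have lv (b : [set b | L b = L (val x)]) :
    [set a : ~` thin L | L (val a) = m] (SigSub (mem_set (th b))).
  by rewrite /= -xm; exact: set_mem (valP b).
by exists (fun b => SigSub (mem_set (lv b))) => b b' [e]; exact: val_inj.
Qed.

(** * The canonical spaces *)

Definition F_level (S : Type) (x : S * nat) : int := - (x.2.+1)%:Z.

Lemma stable_F S : emb nat S -> stable (@F_level S).
Proof.
move=> /emb_prod_nat[h hI].
exists (fun x => (h (x.1.1, x.2), x.1.2)); split=> //.
by move=> [[a i] j] [[b i'] j'] [/hI[-> ->] ->].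
Qed.

(** Cumulated levels: their cardinals are non-decreasing, whereas those of the
levels need not be.  The first component makes them disjoint. *)
Definition E_sets (A : Type) (L : A -> int) (n : nat) : set (nat * A) :=
  [set x | x.1 = n /\ L x.2 <= n].

Definition E_level (A : Type) (L : A -> int) (x : \bigcup_n E_sets L n) : int :=
  (val x).1.

Lemma E_sets_admissible (A G : choiceType) (L : A -> int) :
  ~ emb G nat -> emb A G -> emb G A ->
  (forall n : nat, ~ emb G [set a | L a <= n%:Z]) ->
  E_admissible (E_sets L) G.
Proof.
move=> uG AG GA nG.
have lev n : emb (E_sets L n) [set a | L a <= n%:Z].
  have lm (x : E_sets L n) : [set a | L a <= n%:Z] (val x).2.
    by have /set_mem[] := valP x.
  exists (fun x => SigSub (mem_set (lm x))) => x y /(congr1 val)/= e.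
  have /set_mem[xn _] := valP x; have /set_mem[yn _] := valP y.
  by apply/val_inj/injective_projections; rewrite // xn yn.
have levG n : (E_sets L n #<= [set: G])%card.
  apply/card_le_emb; apply: emb_trans (lev n) _.
  exact: emb_trans (subset_emb _) (emb_trans AG (emb_setT _)).
split.
- by move=> i j _ _ [x [[<- _] [<- _]]].
- move=> m n mn; apply/card_le_emb.
  have h (x : E_sets L m) : E_sets L n (n, (val x).2).
    have /set_mem[_ h] := valP x; split=> //=; apply: le_trans h _.
    by rewrite lez_nat.
  exists (fun x => SigSub (mem_set (h x))) => x y /(congr1 val)[e].
  have /set_mem[xm _] := valP x; have /set_mem[ym _] := valP y.
  by apply/val_inj/injective_projections; rewrite // xm ym.
- split=> // V C EC; apply/card_le_emb; apply: emb_trans (setT_emb _) _.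
  apply: (emb_absorb_nat uG); apply: emb_trans GA _.
  have c n : emb (E_sets L n) C by exact/card_le_emb.
  pose f n := projT1 (cid (c n)).
  have fI n : injective (f n) := projT2 (cid (c n)).
  have am a : E_sets L (absz (Num.max (L a) 0)) (absz (Num.max (L a) 0), a).
    by split => //=; lia.
  exists (fun a => (f _ (SigSub (mem_set (am a))), absz (Num.max (L a) 0))).
  move=> a b [].
  have : forall m n a b (ma : E_sets L m (m, a)) (nb : E_sets L n (n, b)),
      m = n -> f m (SigSub (mem_set ma)) = f n (SigSub (mem_set nb)) -> a = b.
    by move=> m n a' b' ma nb mn; case: n / mn nb => nb /fI [].
  by move=> h e e'; apply: (h _ _ _ _ _ _ e' e).
- move=> n; split=> // /card_le_emb h; apply: (nG n).
  exact: emb_trans (emb_setT _) (emb_trans h (lev n)).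
Qed.

Section Canonical.
Context {R : realType} (p : R) (p1 : 1 < p).
Local Notation pow2 := (@pow2 R _).

(** The atom of weight [2 ^ (- j - 1)] indexed by [s] and [j] is mapped to an
atom of at most this level; there are enough of them by assumption. *)
Lemma iso_F (A S : eqType) (L : A -> int) : stable L -> emb nat S -> emb A S ->
  (forall m : nat, emb S [set a | L a <= - m%:Z]) ->
  iso p (pow2 L) (pow2 (@F_level S)).
Proof.
move=> sL iS [f fI] H; apply: iso_level_emb => //; first exact: stable_F.
  exists 0, (fun a => ((f a, absz (Num.max (- L a - 1) 0)), 0%N)); split.
    by move=> a b [/fI].
  by move=> a; rewrite /F_level/=; lia.
pose g m := projT1 (cid (H m)).
have gI m : injective (g m) := projT2 (cid (H m)).
exists 0, (fun x => (val (g x.2.+1 x.1), x.2)); split.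
  move=> [s i] [t j] /= [+ ij]; rewrite ij => st; congr pair.
  by apply: (gI j.+1); exact: val_inj.
by move=> [s i] /=; rewrite addr0; exact: set_mem (valP (g i.+1 s)).
Qed.

Lemma iso_ell (A S : eqType) (L : A -> int) (l u : int) :
  stable L -> emb nat S -> emb A S -> (forall a, l <= L a) ->
  emb S [set a | L a <= u] -> iso p (pow2 L) (pow2 (fun _ : S => 0)).
Proof.
move=> sL /emb_prod_nat[h hI] [f fI] lL [g gI]; apply: iso_level_emb => //.
- by exists h.
- exists (- l), (fun a => (f a, 0%N)); split; first by move=> a b [/fI].
  by move=> a /=; rewrite subr_ge0.
- exists u, (fun s => (val (g s), 0%N)); split.
    by move=> a b [ab]; apply: gI; exact: val_inj.
  by move=> s; rewrite /= add0r; exact: set_mem (valP (g s)).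
Qed.

(** The atom [(n, a)] has weight [2 ^ n], and [L a <= n]: it splits into copies
of [a], which is why the cumulation of levels does not change the space. *)
Lemma iso_E (A : choiceType) (L : A -> int) (l : int) : stable L ->
  (forall a, l <= L a) -> iso p (pow2 L) (pow2 (@E_level A L)).
Proof.
move=> sL lL; have Emem n a : L a <= n%:Z -> (\bigcup_n E_sets L n) (n, a).
  by move=> Lan; exists n.
have memE (x : \bigcup_n E_sets L n) : L (val x).2 <= (val x).1.
  by have /set_mem[n _ [-> ]] := valP x.
apply: iso_level_emb => //.
- move: sL => [h [hI hL]].
  have hm (x : (\bigcup_n E_sets L n) * nat) :
      L (h ((val x.1).2, x.2)) <= (val x.1).1.
    by rewrite hL; exact: memE.
  exists (fun x => SigSub (mem_set (Emem _ _ (hm x)))); split=> //.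
  move=> [x i] [y j] /(congr1 val)[e /hI[e' ->]]; congr (_, _).
  exact/val_inj/injective_projections.
- have am a : L a <= (absz (Num.max (L a) 0))%:Z by lia.
  exists (`|l|)%R, (fun a => (SigSub (mem_set (Emem _ _ (am a))), 0%N)); split.
    by move=> a b [_ ->].
  by move=> a; rewrite /E_level/=; have := lL a; lia.
- exists 0, (fun x => ((val x).2, (val x).1)); split.
    by move=> x y [e e']; exact/val_inj/injective_projections.
  by move=> x; rewrite addr0; exact: memE.
Qed.

End Canonical.

(** * From bounded operators to isomorphisms of topological vector spaces *)

Section Bridge.
Context {R : realType} (p : R) (p1 : 1 < p).

Let p0 : 0 < p. Proof. exact: lt_trans ltr01 p1. Qed.

Local Notation num w := (fun a => (w a)%:num : R).

Lemma wmu_leP (A : choiceType) (w : A -> {posnum R}) (S : set A) (M : R) :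
  (wmu w S <= M%:E)%E <->
  forall s : seq A, uniq s -> (forall a, a \in s -> S a) ->
    \sum_(a <- s) (w a)%:num <= M.
Proof.
split=> [SM s us sS|h].
  rewrite -lee_fin; apply: le_trans SM; apply: esum_ge.
  exists [set` s]; first by split=> //; exact: finite_seq.
  by rewrite -fsbig_seq// sumEFin.
apply: ge_ereal_sup => _ [F [finF FS] <-].
rewrite fsbig_finite//= sumEFin lee_fin; apply: h => //.
by move=> a; rewrite in_fset_set// => /set_mem/FS.
Qed.

Lemma powRVK (a : R) : 0 <= a -> (a `^ p^-1) `^ p = a.
Proof. by move=> a0; rewrite -powRrM mulVf ?gt_eqF// powRr1. Qed.

Lemma powRKV (a : R) : 0 <= a -> (a `^ p) `^ p^-1 = a.
Proof. by move=> a0; rewrite -powRrM mulfV ?gt_eqF// powRr1. Qed.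

Lemma wnorm_weak_bound (A : choiceType) (w : A -> {posnum R}) (x : A -> R)
    (B : R) :
  (wnorm p w x <= B%:E)%E -> weak_bound p (num w) x (B `^ p).
Proof.
move=> xB s c us c0 sx; set S := \sum_(a <- s) _.
have S0 : 0 <= S by exact: sumr_ge0.
have h : c * S `^ p^-1 <= B.
  rewrite -lee_fin; apply: le_trans xB.
  apply: le_trans (ereal_sup_ubound _); last by exists c.
  rewrite EFinM lee_pmul2l// -poweR_EFin; apply: le_poweRV => //.
  apply: esum_ge; exists [set` s]; first by split=> //; exact: finite_seq.
  by rewrite -fsbig_seq// sumEFin.
have c1 : 0 <= c * S `^ p^-1 by rewrite mulr_ge0 ?powR_ge0// ltW.
rewrite -{1}(powRVK S0) -powRM ?powR_ge0 ?(ltW c0)//.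
by apply: ge0_ler_powR; rewrite ?nnegrE// ?(le_trans c1 h)// ltW.
Qed.

Lemma weak_bound_wnorm (A : choiceType) (w : A -> {posnum R}) (x : A -> R)
    (M : R) :
  weak_bound p (num w) x M -> (wnorm p w x <= (M `^ p^-1)%:E)%E.
Proof.
move=> xM; have M0 := weak_bound_ge0 xM.
apply: ge_ereal_sup => _ [c /= c0 <-].
have h : (wmu w [set g | c < `|x g|]%R <= (M / c `^ p)%:E)%E.
  apply/wmu_leP => s us sx; rewrite ler_pdivlMr ?powR_gt0// mulrC.
  exact: xM.
apply: (@le_trans _ _ (c%:E * (M / c `^ p)%:E `^ p^-1)%E).
  rewrite lee_pmul2l//; apply: le_poweRV h => //; exact: wmu_ge0.
rewrite poweR_EFin -EFinM lee_fin -{1}(powRKV (ltW c0)).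
rewrite -powRM ?powR_ge0 ?divr_ge0 ?powR_ge0//.
by rewrite mulrC divfK// gt_eqF ?powR_gt0.
Qed.

Lemma LpP (A : choiceType) (w : A -> {posnum R}) (x : A -> R) :
  Lp p (num w) x <-> x \in weakLp_pred w p1.
Proof.
split=> [[M /weak_bound_wnorm xM]|]; rewrite inE/=.
  by apply: le_lt_trans xM _; rewrite ltry.
move=> xoo; have xf : wnorm p w x \is a fin_num.
  by rewrite ge0_fin_numE// wnorm_ge0.
by exists ((fine (wnorm p w x)) `^ p); apply: wnorm_weak_bound; rewrite fineK.
Qed.

Section Lift.
Variables (A B : choiceType) (u : A -> {posnum R}) (v : B -> {posnum R}).
Local Notation U := (weakLp p1 u).
Local Notation V := (weakLp p1 v).

Lemma val_Lp (x : U) : Lp p (num u) (val x).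
Proof. exact/LpP/valP. Qed.

Lemma bounded_mem T (x : U) :
  bounded_op p (num u) (num v) T -> T (val x) \in weakLp_pred v p1.
Proof. by move=> bT; apply/LpP/(bounded_Lp bT)/val_Lp. Qed.

Definition lift T (bT : bounded_op p (num u) (num v) T) (x : U) : V :=
  exist _ (T (val x)) (bounded_mem x bT).

Lemma lift_linear T (bT : bounded_op p (num u) (num v) T) : linear (lift bT).
Proof.
move=> k x y; apply: val_inj => /=; exact: (bT.1 k _ _ (val_Lp x) (val_Lp y)).
Qed.

Lemma bounded_ball T (e : R) : bounded_op p (num u) (num v) T -> 0 < e ->
  exists2 d : R, 0 < d &
    forall z, (wnorm p u z < d%:E)%E -> (wnorm p v (T z) < e%:E)%E.
Proof.
move=> [_ [K K0 TK]] e0; pose a := (e / 2) `^ p / (K + 1).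
have K1 : 0 < K + 1 by rewrite ltr_wpDl.
have a0 : 0 < a by apply: divr_gt0 => //; apply: powR_gt0; exact: divr_gt0.
exists (a `^ p^-1); first exact: powR_gt0.
move=> z /ltW/wnorm_weak_bound/TK; rewrite powRVK; last exact: ltW.
move=> /weak_bound_wnorm/le_lt_trans; apply; rewrite lte_fin.
apply: (@le_lt_trans _ _ (e / 2)).
  2: by rewrite ltr_pdivrMr// ltr_pMr// ltr1n.
have e20 : 0 <= e / 2 by rewrite divr_ge0// ltW.
rewrite -[leRHS](powRKV e20).
apply: ge0_ler_powR; rewrite ?nnegrE ?invr_ge0 ?powR_ge0 ?(ltW p0)//.
  by rewrite mulr_ge0// ltW.
by rewrite /a mulrCA ler_piMr ?powR_ge0// ler_pdivrMr// mul1r lerDl.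
Qed.

Lemma lift_continuous T (bT : bounded_op p (num u) (num v) T) :
  continuous (lift bT).
Proof.
move=> x W [e e0 eW]; have [d d0 dT] := bounded_ball bT e0.
exists d => // y /dT yx; apply: eW.
have -> : lift bT y - lift bT x = lift bT (y - x).
  have := lift_linear bT (-1) x y; rewrite !scaleN1r addrC => <-.
  by rewrite addrC.
exact: yx.
Qed.

End Lift.

Lemma exists_linear (U V : preTopologicalLmodType R) (f : U -> V) :
  linear f -> exists g : {linear U -> V}, (g : U -> V) = f.
Proof.
move=> lf; pose M := GRing.isLinear.Build R U V *:%R f lf.
by exists (HB.pack_for {linear U -> V} f M).
Qed.

Lemma iso_isomorphic (A B : choiceType) (u : A -> {posnum R})
    (v : B -> {posnum R}) :
  iso p (num u) (num v) -> isomorphic (weakLp p1 u) (weakLp p1 v).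
Proof.
move=> [T [S [bT bS ST TS]]].
have [f fE] := exists_linear (lift_linear bT).
exists f, (lift bS); rewrite fE; split.
- by move=> x; apply: val_inj; exact: (ST _ (val_Lp x)).
- by move=> x; apply: val_inj; exact: (TS _ (val_Lp x)).
- exact: lift_continuous.
- exact: lift_continuous.
Qed.

Lemma bounded_zero (A B : eqType) (w : A -> R) (v : B -> R) :
  (forall b, 0 < v b) -> bounded_op p w v (fun _ _ => 0).
Proof.
move=> v0; split; first by move=> *; apply/funext => b; rewrite mulr0 addr0.
by exists 0 => // x M _; rewrite mul0r; exact: weak_bound0.
Qed.

Lemma iso_wsum_isomorphic (A B C : choiceType) (u : A -> {posnum R})
    (v : B -> {posnum R}) (w : C -> {posnum R}) :
  iso p (num u) (wsum (num v) (num w)) ->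
  isomorphic (weakLp p1 u) (weakLp p1 v * weakLp p1 w)%type.
Proof.
pose U := weakLp p1 u; pose V := weakLp p1 v; pose W := weakLp p1 w.
move=> [T [S [bT bS ST TS]]].
have v0 a : 0 < (v a)%:num :> R by [].
have w0 a : 0 < (w a)%:num :> R by [].
have bl := bounded_comp (bounded_inl p v0 w0) bT.
have br := bounded_comp (bounded_inr p v0 w0) bT.
have bi' := bounded_case v0 w0 (bounded_id p (num v)) (bounded_zero (num v) w0).
have bj' := bounded_case v0 w0 (bounded_zero (num w) v0) (bounded_id p (num w)).
have bi := bounded_comp bS bi'; have bj := bounded_comp bS bj'.
have lin : linear (fun x : U => (lift bl x, lift br x) : V * W).
  by move=> k x y; congr (_, _); exact: lift_linear.
have [f fE] := exists_linear lin.
have sumE (y : V) (z : W) : sum_rect (fun=> R) (val y) (val z) = fun x =>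
    1 * sum_rect (fun=> R) (val y) (fun=> 0) x +
    sum_rect (fun=> R) (fun=> 0) (val z) x.
  by apply/funext => -[a|a] /=; rewrite mul1r ?addr0 ?add0r.
have Lsum (y : V) (z : W) :
    Lp p (wsum (num v) (num w)) (sum_rect (fun=> R) (val y) (val z)).
  rewrite sumE; apply: LpL; first exact: wsum_gt0.
    exact: bounded_Lp bi' (val_Lp y).
  exact: bounded_Lp bj' (val_Lp z).
pose g (y : V * W) : U := lift bi y.1 + lift bj y.2.
have gE (y : V) (z : W) :
    val (g (y, z)) = S (sum_rect (fun=> R) (val y) (val z)).
  rewrite sumE bS.1; last 2 first.
  - exact: bounded_Lp bi' (val_Lp y).
  - exact: bounded_Lp bj' (val_Lp z).
  by apply/funext => a; rewrite mul1r.
exists f, g; rewrite fE; split.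
- move=> x; apply: val_inj; rewrite gE/= -[RHS](ST _ (val_Lp x)).
  by congr S; apply/funext => -[].
- move=> [y z].
  congr (_, _); apply: val_inj;
    by rewrite -[LHS]/(fun a => T (val (g (y, z))) _) gE (TS _ (Lsum y z)).
- move=> x N [[P Q] [/= xP xQ] PQ].
  have hP : nbhs x (lift bl @^-1` P) := lift_continuous xP.
  have hQ : nbhs x (lift br @^-1` Q) := lift_continuous xQ.
  by apply: filterS (filterI hP hQ) => y [Py Qy]; exact: (PQ (_, _)).
  (* the quasi-triangle inequality costs a factor 4 *)
- move=> [y z] N [e e0 eN]; have e8 : 0 < e / 8 by rewrite divr_gt0.
  have [d d0 dT] := bounded_ball bi e8; have [d' d0' dT'] := bounded_ball bj e8.
  exists ([set y' : V | (wnorm p v (val (y' - y)%R) < d%:E)%E],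
          [set z' : W | (wnorm p w (val (z' - z)%R) < d'%:E)%E]).
    by split; [exists d|exists d'].
  move=> [y' z'] [/= /dT yy' /dT' zz']; apply: (eN (g (y', z'))).
  have -> : g (y', z') - g (y, z) = lift bi (y' - y) + lift bj (z' - z).
    have h1 := lift_linear bi (-1) y y'; have h2 := lift_linear bj (-1) z z'.
    rewrite !scaleN1r in h1 h2.
    rewrite /g/= [y' - y]addrC h1 [z' - z]addrC h2 opprD addrACA.
    by congr (_ + _); exact: addrC.
  apply: le_lt_trans (wnormD p1 (ltW yy') (ltW zz')) _.
  by rewrite -EFinM lte_fin mulrCA gtr_pMr// ltr_pdivrMr// mul1r ltr_nat.
Qed.

End Bridge.

(** * Classification *)

Section Classification.
Context {R : realType} (p : R) (p1 : 1 < p).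
Local Notation num w := (fun a => (w a)%:num : R).
Local Notation pow2 := (@pow2 R _).

Lemma pow2_round (x : R) : 0 < x -> exists m : int, 2 ^ m <= x <= 2 * 2 ^ m.
Proof.
move=> x0; have ln2 : 0 < ln (2 : R) by rewrite ln_gt0// ltr1n.
pose t := ln x / ln 2; have xE : x = 2 `^ t.
  by rewrite /powR gt_eqF// /t divfK ?gt_eqF// lnK.
exists (Num.floor t).
have -> : 2 * 2 ^ Num.floor t = 2 ^ (Num.floor t + 1) :> R.
  by rewrite expfzDr// expr1z mulrC.
rewrite -!powR_intmul// xE !ler_powR ?ler1n//; last first.
  exact: real_floor_le (num_real t).
exact: ltW (real_floorD1_gt (num_real t)).
Qed.

Lemma iso_round (A : eqType) (w : A -> {posnum R}) :
  exists L : A -> int, iso p (num w) (pow2 L).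
Proof.
have h a : exists m : int, (2 : R) ^ m <= (w a)%:num <= 2 * 2 ^ m.
  exact: pow2_round.
pose L a := projT1 (cid (h a)).
have LP a : (2 : R) ^ L a <= (w a)%:num <= 2 * 2 ^ L a := projT2 (cid (h a)).
exists L; apply: (@iso_bij _ p _ _ _ _ id id 2) => // a; first exact: pow2_gt0.
  by have /andP[] := LP a.
by have /andP[/le_trans + _] := LP a; apply; rewrite ler_peMl// ler1n.
Qed.

Lemma num_ell (S : choiceType) :
  num (fun _ : S => 1%:pos : {posnum R}) = pow2 (fun _ : S => 0).
Proof. by apply/funext => s; rewrite /pow2 expr0z. Qed.

Lemma num_F (S : choiceType) :
  num (fun g : S * nat => (2^-1 ^+ g.2.+1)%:pos : {posnum R}) =
  pow2 (@F_level S).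
Proof. by apply/funext => s; rewrite /pow2 /F_level/= exprVn -exprnN. Qed.

Lemma num_E (A : choiceType) (L : A -> int) :
  num (@Eweight R (nat * A)%type (E_sets L)) = pow2 (@E_level A L).
Proof.
apply/funext => x; rewrite /pow2 /E_level /Eweight/= exprnP; congr (_ ^ Posz _).
have /set_mem[n _ xn] := valP x.
by case: xgetP => [m _ [-> _]//|/(_ n)].
Qed.

Lemma pow2_split (A : choiceType) (L : A -> int) (D : set A) :
  iso p (pow2 L) (wsum (pow2 (fun x : (~` D : set A) => L (val x)))
                     (pow2 (fun x : D => L (val x)))).
Proof.
pose f (x : A) : ((~` D : set A) + D)%type := match pselect (D x) with
  | left Dx => inr (SigSub (mem_set Dx))
  | right nDx => inl (SigSub (mem_set (nDx : (~` D) x))) end.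
pose g (x : (~` D : set A) + D) :=
  match x with inl a => val a | inr a => val a end.
have fg x : g (f x) = x by rewrite /f; case: pselect.
have gf x : f (g x) = x.
  case: x => x; rewrite /g /f; have /set_mem := valP x; case: pselect => // h _;
  by congr (_ _); apply: val_inj.
have wE x : wsum (pow2 (fun x : (~` D : set A) => L (val x)))
    (pow2 (fun x : D => L (val x))) x = pow2 L (g x) by case: x.
by apply: (@iso_bij _ p _ _ _ _ f g 1) => // a;
  rewrite ?mul1r ?wE ?fg ?pow2_gt0.
Qed.

Lemma ell_or_E (A G : choiceType) (L : A -> int) (l : int) :
  ~ emb G nat -> emb A G -> emb G A -> stable L -> (forall a, l <= L a) ->
  iso p (pow2 L) (num (fun _ : G => 1%:pos : {posnum R})) \/
  exists (T : choiceType) (P : nat -> set T),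
    E_admissible P G /\ iso p (pow2 L) (num (@Eweight R T P)).
Proof.
move=> uG AG GA sL lL.
have [[n Gn]|nG] := pselect (exists n : nat, emb G [set a | L a <= n%:Z]).
  left; rewrite num_ell.
  exact: (iso_ell p1 sL) (uncountable_infinite uG) AG lL Gn.
right; exists (nat * A)%type, (E_sets L); split.
  by apply: E_sets_admissible => // n Gn; apply: nG; exists n.
by rewrite num_E; exact: iso_E lL.
Qed.

Lemma card_lt_type (A B : Type) :
  card_lt [set: A] [set: B] <-> emb A B /\ ~ emb B A.
Proof.
have cE X Y : ([set: X] #<= [set: Y])%card <-> emb X Y.
  rewrite card_le_emb; split=> h.
    exact: emb_trans (emb_setT _) (emb_trans h (setT_emb _)).
  exact: emb_trans (setT_emb _) (emb_trans h (emb_setT _)).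
by rewrite /card_lt !cE.
Qed.

(** The thin atoms are countably many, hence absorbed by the others. *)
Lemma thick_part (G : choiceType) (L : G -> int) : ~ emb G nat ->
  exists (A : choiceType) (M : A -> int),
    [/\ emb G A, emb A G, stable M & iso p (pow2 L) (pow2 M)].
Proof.
move=> uG; have cD := thin_countable L.
have GA : emb G (~` thin L : set G).
  by apply: (emb_setC uG); move=> GD; apply: uG; exact: emb_trans cD.
exists (set_type (~` thin L)), (fun x => L (val x)); split=> //.
- exact: subset_emb.
- exact: stable_thick.
- apply: iso_trans (pow2_split _ (thin L)) _.
  by apply: (iso_countable p1 _ _ cD) => h; apply: uG; exact: emb_trans h.
Qed.

End Classification.

Theorem theorem18 (R : realType) (p : R) (p1 : 1 < p) (G : choiceType)
    (w : G -> {posnum R}) (G_uncountable : ~ countable [set: G]) :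
  [\/ isomorphic (weakLp p1 w) (ell p1 G),
      (exists (T : choiceType) (P : nat -> set T),
         E_admissible P G /\ isomorphic (weakLp p1 w) (E p1 P)),
      isomorphic (weakLp p1 w) (F p1 G) |
   [\/ (exists S : choiceType,
         [/\ card_lt [set: nat] [set: S], card_lt [set: S] [set: G] &
             isomorphic (weakLp p1 w) (ell p1 G * F p1 S)%type]) |
      (exists (T : choiceType) (P : nat -> set T) (S : choiceType),
         [/\ E_admissible P G,
             card_lt [set: nat] [set: S], card_lt [set: S] [set: G] &
             isomorphic (weakLp p1 w) (E p1 P * F p1 S)%type])]].
Proof.
have uG : ~ emb G nat by move=> /countable_emb.
have iG := uncountable_infinite uG.
have [L0 wL0] := iso_round p w.
have [A [L [GA AG sL /(iso_trans wL0) wL]]] := thick_part p1 L0 uG.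
pose T (m : nat) := [set a | L a <= - m%:Z].
have [GT|/existsNP[m0 nGT]] := pselect (forall m, emb G (T m)).
  apply: Or43; apply: iso_isomorphic; apply: iso_trans wL _.
  by rewrite num_F; exact: iso_F.
have TT m n : (m <= n)%N -> emb (T n) (T m).
  move=> mn; have h (x : T n) : T m (val x).
    by have /set_mem/le_trans := valP x; apply; rewrite lerN2 lez_nat.
  by exists (fun x => SigSub (mem_set (h x))) => x y [e]; exact: val_inj.
(* [T N] has the least cardinal among the [T m]; it may be taken with [N >= m0],
   and is then smaller than [G] *)
have [k kmin] := exists_smallest 0%N (fun k => T (m0 + k)%N).
pose N := (m0 + k)%N.
have Tmin m : emb (T N) (T m).
  apply: emb_trans (kmin m) (TT _ _ _); exact: leq_addl.
have nGN : ~ emb G (T N).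
  by move=> h; apply: nGT; apply: emb_trans h (TT _ _ _); exact: leq_addr.
have wS := iso_trans wL (pow2_split p L (T N)).
set B : Type := set_type (~` T N) in wS.
have GB : emb G B.
  have uA : ~ emb A nat by move=> h; exact: uG (emb_trans GA h).
  have nAN : ~ emb A (T N) by move=> h; exact: nGN (emb_trans GA h).
  exact: emb_trans GA (emb_setC uA nAN).
have BG : emb B G := emb_trans (subset_emb _) AG.
have sB : stable (fun x : B => L (val x)).
  exact: (stable_sub (fun l => ~ (l <= - N%:Z)) sL).
have lB (b : B) : - N%:Z <= L (val b).
  by have /set_mem/negP := valP b; rewrite -ltNge => /ltW.
have B_cases := ell_or_E p1 uG BG GB sB lB.
have [cT|uT] := pselect (emb (T N) nat).
  have wB : iso p (fun g => (w g)%:num) (pow2 (fun x : B => L (val x))).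
    apply: iso_trans wS _; apply: (iso_countable p1 _ _ cT).
    by move=> h; exact: uG (emb_trans GB h).
  have [h|[X [P [PG h]]]] := B_cases.
    by apply: Or41; apply: iso_isomorphic; exact: iso_trans h.
  apply: Or42; exists X, P; split=> //.
  by apply: iso_isomorphic; exact: iso_trans h.
have iT := uncountable_infinite uT.
have sT : stable (fun x : T N => L (val x)).
  exact: (stable_sub (fun l => l <= - N%:Z) sL).
have wT : iso p (pow2 (fun x : T N => L (val x)))
    (fun g : T N * nat => ((2^-1 ^+ g.2.+1)%:pos : {posnum R})%:num).
  rewrite num_F; apply: iso_F => //; first exact: emb_refl.
  move=> m; apply: emb_trans (Tmin (maxn m N)) _.
  have h1 (x : T (maxn m N)) : T N (val x).
    have /set_mem/le_trans := valP x; apply; rewrite lerN2 lez_nat.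
    exact: leq_maxr.
  have h2 (x : T (maxn m N)) :
      [set a : T N | L (val a) <= - m%:Z] (SigSub (mem_set (h1 x))).
    have /set_mem/le_trans := valP x; apply; rewrite lerN2 lez_nat.
    exact: leq_maxl.
  by exists (fun x => SigSub (mem_set (h2 x))) => x y [e]; exact: val_inj.
have cT1 : card_lt [set: nat] [set: T N] by exact/card_lt_type.
have cT2 : card_lt [set: T N] [set: G].
  by apply/card_lt_type; split=> //; exact: emb_trans (subset_emb _) AG.
apply: Or44; have [h|[X [P [PG h]]]] := B_cases.
  left; exists (T N); split=> //; apply: iso_wsum_isomorphic.
  apply: iso_trans wS (iso_sum _ _ _ _ h wT) => // a; exact: pow2_gt0.
right; exists X, P, (T N); split=> //; apply: iso_wsum_isomorphic.
apply: iso_trans wS (iso_sum _ _ _ _ h wT) => // a; exact: pow2_gt0.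
Qed.
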